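(* With the infinite product understood as a zeta-regularized product, i.e. $\prod_{n=1}^\infty n^{(-1)^nn}=\exp(\zeta_E'(-1))$, one has $$\prod_{n=1}^\infty n^{(-1)^nn}=2^{-1/3}e^{-1/4}A^3,$$ where $A$ is the Glaisher–Kinkelin constant.
   Context: $\zeta_E(s)=\sum_{m=1}^\infty(-1)^{m+1}m^{-s}$ for $\mathrm{Re}(s)>0$, continued analytically to an entire function of $s$. The zeta-regularized product $\prod_{n=1}^\infty n^{(-1)^nn}$ is by definition $\exp\left(\frac{d}{ds}\sum_{n=1}^\infty(-1)^{n+1}n\cdot n^{-s}\big|_{s=0}\right)=\exp(\zeta_E'(-1))$ (after analytic continuation). The Glaisher–Kinkelin constant is $A=\lim_{n\to\infty}\frac{\prod_{k=1}^nk^k}{n^{n^2/2+n/2+1/12}}e^{n^2/4}=e^{1/12-\zeta'(-1)}=1.282427130\ldots$, with $\zeta$ the Riemann zeta function. *)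

(* Defs.v *)
From Stdlib Require Import Reals ClassicalEpsilon.
From Coquelicot Require Import Coquelicot.

Local Open Scope R_scope.

Definition Cexp (z : C) : C := (exp (Re z) * cos (Im z), exp (Re z) * sin (Im z)).

(* n^s for an integer n >= 1, with the real logarithm of n. *)
Definition nat_Cpower (n : nat) (s : C) : C := Cexp (s * RtoC (ln (INR n)))%C.

Definition entire (f : C -> C) : Prop :=
  forall s : C, @ex_derive C_AbsRing C_NormedModule f s.

(* The term of index k is the one of index m = k + 1 in
   sum_(m >= 1) (-1)^(m+1) m^(-s). *)
Definition zetaE_term (s : C) (k : nat) : C :=
  (RtoC ((-1) ^ k) * nat_Cpower (S k) (- s))%C.

Definition is_zetaE (f : C -> C) : Prop :=
  entire f /\
  forall s : C, 0 < Re s -> @is_series C_AbsRing C_NormedModule (zetaE_term s) (f s).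

(* The unique entire function with this property; nothing can be proved about
   its values before the existence of the continuation is established. *)
Definition zetaE : C -> C := epsilon (inhabits (fun _ : C => RtoC 0)) is_zetaE.

(* The zeta-regularized value of prod_(n >= 1) n^((-1)^n n): formally
   d/ds sum_(n >= 1) (-1)^(n+1) n n^(-s) at s = 0 is zetaE'(-1). *)
Definition zeta_reg_prod : C := Cexp (C_derive zetaE (RtoC (-1))).

(* prod_(k = 1)^n k^k: the extra factor k = 0 is 0 ^ 0 = 1. *)
Definition hyperfactorial (n : nat) : R := prod_f_R0 (fun k => INR k ^ k) n.

Definition glaisher_seq (n : nat) : R :=
  hyperfactorial n / Rpower (INR n) (INR n ^ 2 / 2 + INR n / 2 + 1 / 12)
  * exp (INR n ^ 2 / 4).

Definition glaisher : R := real (Lim_seq glaisher_seq).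

(* Main.v *)
Require Import Defs.
From Stdlib Require Import Reals Lra Lia Psatz ClassicalEpsilon.
From Coquelicot Require Import Coquelicot.
Local Open Scope R_scope.

(** Three facts combine: the alternating zeta function has at most one entire
    continuation, it has one whose derivative is the repeatedly averaged
    differentiated series, and at -1 that averaged series can be compared with
    the logarithm of the hyperfactorial.

    Uniqueness ([is_zetaE_unique]).  The difference g of two continuations is
    entire and vanishes for Re s > 0.  For a fixed s the product
    F(z) = g(s + z) g(s + iz) g(s - z) g(s - iz) vanishes as soon as |z| is large,
    because one of the four points then lies in the right half-plane.  An
    entire function vanishing outside a disc vanishes at 0: its mean over the
    circle of radius e^x is independent of x, by Goursat's theorem for F(e^w) on
    a rectangle of height 2 pi; this mean is 0 for large x and tends to F(0) as
    x tends to minus infinity.  Hence g(s)^4 = F(0) = 0.  Goursat's theorem is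
    proved by bisection, for real closed forms whose coefficients are only
    differentiable ([Goursat_closed_form]).

    Existence ([exists_continuation], [Euler_sum_is_derive]).  Averaging
    consecutive partial sums k times turns the step from n to n + 1 into
    2^-k times a k-th difference of x^-s, of order n^(-Re s - k).  So for every s
    the partial sums become convergent after enough averaging, and since
    averaging preserves limits the value does not depend on the number of
    averages.  The same bounds hold for the series differentiated
    once and twice in s, locally uniformly in s; the second-order Taylor
    estimate of the averaged sums passes to the limit, which shows that the
    continuation is differentiable and that its derivative is obtained by
    averaging the differentiated series.

    Value ([Euler_sum_alt_xlnx]).  Let H(n) be the hyperfactorial and V(N) the sum of
    (-1)^m m ln m for m <= N, the differentiated partial sum at -1.  Separating
    even and odd m gives
    V(2n) = 4 ln H(n) + 2 n (n + 1) ln 2 - ln H(2n).  By the definition of the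
    Glaisher-Kinkelin constant A,
    V(N) = 3 ln A - (ln 2) / 3 - 1/4 + (-1)^N (N ln N / 2 + ln N / 4 + 1/4) + o(1),
    and averaging kills the oscillating term.  Hence
    zeta_E'(-1) = 3 ln A - (ln 2) / 3 - 1/4. *)

(** * Complex-valued functions of a real variable *)

Lemma Cmod_le_Re_Im (z : C) : Cmod z <= Rabs (Re z) + Rabs (Im z).
Proof.
  destruct z as [x y]; unfold Cmod, Re, Im; simpl.
  rewrite <- (sqrt_pow2 (Rabs x + Rabs y)).
  - apply sqrt_le_1_alt.
    assert (H1 := pow2_abs x). assert (H2 := pow2_abs y). assert (H3 := Rabs_pos x).
    assert (H4 := Rabs_pos y). nra.
  - apply Rplus_le_le_0_compat; apply Rabs_pos.
Qed.

Lemma im_le_Cmod (z : C) : Rabs (Im z) <= Cmod z.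
Proof. eapply Rle_trans; [apply Rmax_r | apply (Rmax_Cmod z)]. Qed.

(** Complex derivatives are used below only through this epsilon-delta form,
    centred at the increment [w]. *)
Lemma C_is_derive_eps (f : C -> C) (s l : C) :
  @is_derive C_AbsRing C_NormedModule f s l <->
  forall eps, 0 < eps -> exists d, 0 < d /\ forall w, Cmod w < d ->
    Cmod (f (s + w) - f s - w * l)%C <= eps * Cmod w.
Proof.
  split.
  - intros [_ H] eps He.
    destruct (H s (fun P HP => HP) (mkposreal eps He)) as [d Hd].
    exists d; split; [apply cond_pos|]. intros w Hw.
    specialize (Hd (s + w)%C).
    replace (f (s + w) - f s - w * l)%C with (f (s + w) - f s - (s + w - s) * l)%C by ring.
    replace (Cmod w) with (Cmod (s + w - s)) by (f_equal; ring).
    apply Hd. change (Cmod (s + w - s) < d).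
    replace (s + w - s)%C with w by ring. exact Hw.
  - intros H. split.
    + apply (@is_linear_scal_l C_AbsRing C_NormedModule).
    + intros x Hx.
      (* A limit of the neighbourhood filter of [s] can only be [s]. *)
      assert (E : x = s).
      { symmetry. apply (@is_filter_lim_locally_unique C_AbsRing (AbsRing_NormedModule C_AbsRing)).
        exact Hx. }
      subst x. intros [eps He].
      destruct (H eps He) as [d [Hd0 Hd]].
      assert (K : forall y : C, Cmod (y - s) < d ->
        Cmod (f y - f s - (y - s) * l) <= eps * Cmod (y - s)).
      { intros y Hy. specialize (Hd (y - s)%C Hy).
        replace (s + (y - s))%C with y in Hd by ring. exact Hd. }
      exists (mkposreal d Hd0). exact K.
Qed.

Lemma C_filterlim_components (u : nat -> C) (l : C) :
  is_lim_seq (fun n => Re (u n)) (Re l) -> is_lim_seq (fun n => Im (u n)) (Im l) ->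
  filterlim u eventually (@locally C_NormedModule l).
Proof.
  intros Hr Hi. apply (@filterlim_locally _ C_UniformSpace eventually _). intros eps.
  apply is_lim_seq_spec in Hr. apply is_lim_seq_spec in Hi.
  destruct (Hr eps) as [N1 H1], (Hi eps) as [N2 H2].
  exists (max N1 N2). intros n Hn. split; [apply H1 | apply H2]; lia.
Qed.

(** Working with the two real components makes the real mean value theorem
    and [is_lim_seq] available to complex-valued functions. *)
Definition is_Rderive (f : R -> C) (x : R) (l : C) : Prop :=
  is_derive (fun t => Re (f t)) x (Re l) /\ is_derive (fun t => Im (f t)) x (Im l).

Lemma is_Rderive_plus (f g : R -> C) x l m :
  is_Rderive f x l -> is_Rderive g x m -> is_Rderive (fun t => f t + g t)%C x (l + m)%C.
Proof.
  intros [H1 H2] [H3 H4]; split; simpl.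
  - exact (is_derive_plus _ _ _ _ _ H1 H3).
  - exact (is_derive_plus _ _ _ _ _ H2 H4).
Qed.

Lemma is_Rderive_minus (f g : R -> C) x l m :
  is_Rderive f x l -> is_Rderive g x m -> is_Rderive (fun t => f t - g t)%C x (l - m)%C.
Proof.
  intros [H1 H2] [H3 H4]; split.
  - exact (is_derive_minus _ _ _ _ _ H1 H3).
  - exact (is_derive_minus _ _ _ _ _ H2 H4).
Qed.

Lemma is_Rderive_const (c : C) x : is_Rderive (fun _ => c) x 0%C.
Proof. split; apply @is_derive_const. Qed.

Lemma is_derive_Rmult (f g : R -> R) x l m :
  is_derive f x l -> is_derive g x m ->
  is_derive (fun t => f t * g t) x (l * g x + f x * m).
Proof. intros Hf Hg. apply (is_derive_mult f g x l m Hf Hg). intros; apply Rmult_comm. Qed.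

Lemma is_Rderive_mult (f g : R -> C) x l m :
  is_Rderive f x l -> is_Rderive g x m ->
  is_Rderive (fun t => f t * g t)%C x (l * g x + f x * m)%C.
Proof.
  intros [H1 H2] [H3 H4]; split; simpl.
  - replace (_ + _) with
      ((Re l * Re (g x) + Re (f x) * Re m) - (Im l * Im (g x) + Im (f x) * Im m))
      by (unfold Re, Im; ring).
    apply (is_derive_minus (fun t => Re (f t) * Re (g t)) (fun t => Im (f t) * Im (g t)));
      apply is_derive_Rmult; assumption.
  - replace (_ + _) with
      ((Re l * Im (g x) + Re (f x) * Im m) + (Im l * Re (g x) + Im (f x) * Re m))
      by (unfold Re, Im; ring).
    apply (is_derive_plus (fun t => Re (f t) * Im (g t)) (fun t => Im (f t) * Re (g t)));
      apply is_derive_Rmult; assumption.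
Qed.

Lemma is_Rderive_RtoC (f : R -> R) x l :
  is_derive f x l -> is_Rderive (fun t => RtoC (f t)) x (RtoC l).
Proof. intros H; split; [exact H | exact (@is_derive_const R_AbsRing R_NormedModule 0 x)]. Qed.

Lemma is_Rderive_id x : is_Rderive (fun t => RtoC t) x 1%C.
Proof. apply is_Rderive_RtoC. exact (@is_derive_id R_AbsRing x). Qed.

Lemma is_Rderive_eq (f : R -> C) x l m : is_Rderive f x l -> l = m -> is_Rderive f x m.
Proof. intros H <-; exact H. Qed.

Lemma is_Rderive_scal (c : C) (f : R -> C) x l :
  is_Rderive f x l -> is_Rderive (fun t => c * f t)%C x (c * l)%C.
Proof.
  intros H. eapply is_Rderive_eq; [apply is_Rderive_mult; [apply is_Rderive_const | exact H]|].
  cbv beta; ring.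
Qed.

Lemma is_Rderive_shift (f : R -> C) (x l' : R) l :
  is_Rderive f (x + l') l -> is_Rderive (fun t => f (t + l')) x l.
Proof.
  intros [H1 H2].
  assert (K : is_derive (fun t => t + l') x 1).
  { replace 1 with (1 + 0) by ring.
    apply (is_derive_plus (fun t => t) (fun _ => l') x 1 0).
    - exact (@is_derive_id R_AbsRing x).
    - exact (@is_derive_const R_AbsRing R_NormedModule l' x). }
  split.
  - replace (Re l) with (1 * Re l) by ring.
    exact (is_derive_comp (fun t => Re (f t)) (fun t => t + l') x (Re l) 1 H1 K).
  - replace (Im l) with (1 * Im l) by ring.
    exact (is_derive_comp (fun t => Im (f t)) (fun t => t + l') x (Im l) 1 H2 K).
Qed.

Lemma Cexp_plus (z w : C) : Cexp (z + w) = (Cexp z * Cexp w)%C.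
Proof.
  destruct z as [a b], w as [c d]; unfold Cexp, Re, Im, Cplus, Cmult; simpl.
  rewrite exp_plus, cos_plus, sin_plus. f_equal; ring.
Qed.

Lemma Cexp_RtoC (x : R) : Cexp (RtoC x) = RtoC (exp x).
Proof. unfold Cexp, RtoC; simpl. rewrite cos_0, sin_0. f_equal; ring. Qed.

Lemma Cmod_Cexp (z : C) : Cmod (Cexp z) = exp (Re z).
Proof.
  unfold Cmod, Cexp; simpl.
  replace (_ + _) with (exp (Re z) ^ 2 * ((sin (Im z))² + (cos (Im z))²)) by (unfold Rsqr; ring).
  rewrite sin2_cos2, Rmult_1_r. apply sqrt_pow2, Rlt_le, exp_pos.
Qed.

Lemma is_Rderive_Cexp (f : R -> C) x l :
  is_Rderive f x l -> is_Rderive (fun t => Cexp (f t)) x (l * Cexp (f x))%C.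
Proof.
  intros [H1 H2].
  assert (He : is_derive (fun t => exp (Re (f t))) x (Re l * exp (Re (f x)))).
  { apply (is_derive_comp exp (fun t => Re (f t))); [apply is_derive_Reals, derivable_pt_lim_exp | exact H1]. }
  assert (Hc : is_derive (fun t => cos (Im (f t))) x (Im l * - sin (Im (f x)))).
  { apply (is_derive_comp cos (fun t => Im (f t))); [apply is_derive_Reals, derivable_pt_lim_cos | exact H2]. }
  assert (Hs : is_derive (fun t => sin (Im (f t))) x (Im l * cos (Im (f x)))).
  { apply (is_derive_comp sin (fun t => Im (f t))); [apply is_derive_Reals, derivable_pt_lim_sin | exact H2]. }
  split; simpl.
  - replace (_ - _) with (Re l * exp (Re (f x)) * cos (Im (f x)) + exp (Re (f x)) * (Im l * - sin (Im (f x))))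
      by (unfold Re, Im; ring).
    apply (is_derive_Rmult (fun t => exp (Re (f t))) (fun t => cos (Im (f t)))); assumption.
  - replace (_ + _) with (Re l * exp (Re (f x)) * sin (Im (f x)) + exp (Re (f x)) * (Im l * cos (Im (f x))))
      by (unfold Re, Im; ring).
    apply (is_derive_Rmult (fun t => exp (Re (f t))) (fun t => sin (Im (f t)))); assumption.
Qed.

(** The mean value inequality holds for each real component; adding the two
    components costs the factor 2, which is harmless here. *)
Lemma is_Rderive_bound (f f' : R -> C) (a b M : R) :
  a <= b -> (forall t, a <= t <= b -> is_Rderive f t (f' t)) ->
  (forall t, a <= t <= b -> Cmod (f' t) <= M) ->
  Cmod (f b - f a) <= 2 * M * (b - a).
Proof.
  intros Hab Hd HM.
  assert (K : forall g g' : R -> R, (forall t, a <= t <= b -> is_derive g t (g' t)) ->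
     (forall t, a <= t <= b -> Rabs (g' t) <= M) -> Rabs (g b - g a) <= M * (b - a)).
  { intros g g' Hg Hg'.
    destruct (MVT_abs g g' a b) as [c [E Hc]];
      rewrite ?Rmin_left, ?Rmax_right in * by assumption.
    - intros c Hc. apply is_derive_Reals, Hg, Hc.
    - rewrite E, (Rabs_pos_eq (b - a)) by lra.
      apply Rmult_le_compat_r; [lra | apply Hg', Hc]. }
  eapply Rle_trans; [apply Cmod_le_Re_Im|].
  assert (K1 := K (fun t => Re (f t)) (fun t => Re (f' t)) (fun t Ht => proj1 (Hd t Ht))
    (fun t Ht => Rle_trans _ _ _ (re_le_Cmod _) (HM t Ht))).
  assert (K2 := K (fun t => Im (f t)) (fun t => Im (f' t)) (fun t Ht => proj2 (Hd t Ht))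
    (fun t Ht => Rle_trans _ _ _ (im_le_Cmod _) (HM t Ht))).
  replace (Re (f b - f a)) with (Re (f b) - Re (f a)) by (simpl; unfold Re; ring).
  replace (Im (f b - f a)) with (Im (f b) - Im (f a)) by (simpl; unfold Im; ring).
  simpl in K1, K2. lra.
Qed.

(** A second-order Taylor estimate for [T] from derivatives along the segment
    from [s] to [s + w] only.  [T1] and [T2] play the roles of the first and
    second derivative; complex differentiability of [T] is a consequence
    (see [C_is_derive_quadratic]). The bound involves [T2] alone, so it is
    uniform over families with bounded second derivatives. *)
Lemma Taylor_bound (T T1 T2 : C -> C) (s w : C) (B : R) :
  (forall t, is_Rderive (fun t => T (s + RtoC t * w)%C) t (w * T1 (s + RtoC t * w))%C) ->
  (forall t, is_Rderive (fun t => T1 (s + RtoC t * w)%C) t (w * T2 (s + RtoC t * w))%C) ->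
  (forall t, 0 <= t <= 1 -> Cmod (T2 (s + RtoC t * w)%C) <= B) ->
  Cmod (T (s + w) - T s - w * T1 s)%C <= 4 * B * Cmod w ^ 2.
Proof.
  intros H1 H2 HB.
  assert (HB0 : 0 <= B).
  { eapply Rle_trans; [apply Cmod_ge_0 | apply (HB 0); lra]. }
  assert (E0 : (s + RtoC 0 * w)%C = s) by ring.
  assert (E1 : (s + RtoC 1 * w)%C = (s + w)%C) by ring.
  assert (K : forall t, 0 <= t <= 1 ->
     Cmod (T1 (s + RtoC t * w) - T1 s)%C <= 2 * (Cmod w * B)).
  { intros t Ht.
    assert (X := is_Rderive_bound (fun t => T1 (s + RtoC t * w)%C)
      (fun t => w * T2 (s + RtoC t * w))%C 0 t (Cmod w * B)).
    simpl in X. rewrite E0 in X. eapply Rle_trans; [apply X|].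
    - lra.
    - intros u _; apply H2.
    - intros u Hu. rewrite Cmod_mult. apply Rmult_le_compat_l; [apply Cmod_ge_0|].
      apply HB; lra.
    - assert (0 <= Cmod w * B) by (apply Rmult_le_pos; [apply Cmod_ge_0 | assumption]).
      nra. }
  assert (X := is_Rderive_bound (fun t => T (s + RtoC t * w) + RtoC t * (- w * T1 s))%C
      (fun t => w * (T1 (s + RtoC t * w) - T1 s))%C 0 1 (Cmod w * (2 * (Cmod w * B)))).
  simpl in X. rewrite E0, E1 in X.
  replace (T (s + w) - T s - w * T1 s)%C with
    (T (s + w) + RtoC 1 * (- w * T1 s) - (T s + RtoC 0 * (- w * T1 s)))%C by ring.
  eapply Rle_trans; [apply X|].
  - lra.
  - intros u _. eapply is_Rderive_eq; [apply is_Rderive_plus; [apply H1|]|].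
    + apply is_Rderive_mult; [apply is_Rderive_id | apply is_Rderive_const].
    + cbv beta; ring.
  - intros u Hu. rewrite Cmod_mult. apply Rmult_le_compat_l; [apply Cmod_ge_0|].
    apply K; lra.
  - apply Req_le; ring.
Qed.

Lemma C_is_derive_quadratic (f : C -> C) (s l : C) (d B : R) :
  0 < d -> (forall w, Cmod w < d -> Cmod (f (s + w) - f s - w * l)%C <= B * Cmod w ^ 2) ->
  @is_derive C_AbsRing C_NormedModule f s l.
Proof.
  intros Hd H. apply C_is_derive_eps. intros eps He.
  assert (HB := Rabs_pos B).
  exists (Rmin d (eps / (Rabs B + 1))). split.
  - apply Rmin_pos; [assumption | apply Rdiv_lt_0_compat; lra].
  - intros w Hw.
    assert (Hw1 := Rlt_le_trans _ _ _ Hw (Rmin_l _ _)).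
    assert (Hw2 := Rlt_le_trans _ _ _ Hw (Rmin_r _ _)).
    eapply Rle_trans; [apply H; assumption|].
    assert (Hw0 := Cmod_ge_0 w). assert (HB1 := Rle_abs B).
    assert ((Rabs B + 1) * Cmod w < eps).
    { apply (Rmult_lt_compat_l (Rabs B + 1)) in Hw2; [|lra].
      replace ((Rabs B + 1) * (eps / (Rabs B + 1))) with eps in Hw2 by (field; lra). lra. }
    nra.
Qed.

Lemma is_Rderive_line (s w : C) (t : R) : is_Rderive (fun t => s + RtoC t * w)%C t w.
Proof.
  eapply is_Rderive_eq.
  - apply is_Rderive_plus; [apply is_Rderive_const|].
    apply is_Rderive_mult; [apply is_Rderive_id | apply is_Rderive_const].
  - cbv beta; ring.
Qed.

Lemma is_derive_Cexp (s : C) : @is_derive C_AbsRing C_NormedModule Cexp s (Cexp s).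
Proof.
  apply (C_is_derive_quadratic _ _ _ 1 (4 * exp (Re s + 1))); [lra|].
  intros w Hw. apply (Taylor_bound Cexp Cexp Cexp).
  1, 2: intros t; apply (is_Rderive_Cexp (fun t => s + RtoC t * w)%C), is_Rderive_line.
  intros t Ht. rewrite Cmod_Cexp.
  assert (X : Re (s + RtoC t * w) <= Re s + 1).
  { replace (Re (s + RtoC t * w)) with (Re s + t * Re w) by (simpl; unfold Re; ring).
    assert (Y := re_le_Cmod w). assert (Z := Rle_abs (Re w)). nra. }
  destruct X as [X | ->]; [left; apply exp_increasing, X | right; reflexivity].
Qed.

(** * Goursat's theorem for closed forms on rectangles *)

(** The form P dx + Q dy is differentiable at every point, with equal mixed
    coefficients [k]: the partial derivative of P in y is that of Q in x.
    This is differentiability alone, without continuity of the derivatives, so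
    Green's formula must be replaced by a bisection argument. *)
Definition closed_form (P Q : R -> R -> R) : Prop :=
  forall x0 y0, exists p k q, forall eps, 0 < eps -> exists d, 0 < d /\
  forall x y, Rabs (x - x0) < d -> Rabs (y - y0) < d ->
    Rabs (P x y - (P x0 y0 + p * (x - x0) + k * (y - y0)))
      <= eps * (Rabs (x - x0) + Rabs (y - y0)) /\
    Rabs (Q x y - (Q x0 y0 + k * (x - x0) + q * (y - y0)))
      <= eps * (Rabs (x - x0) + Rabs (y - y0)).

(** The integral of P dx + Q dy along the boundary of the rectangle
    [a, b] x [c, d], with opposite sides grouped in one integral. *)
Definition circulation (P Q : R -> R -> R) (a b c d : R) : R :=
  RInt (fun x => P x c - P x d) a b + RInt (fun y => Q b y - Q a y) c d.

Lemma continuous_of_Lipschitz_at (f : R -> R) (x K d : R) :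
  0 < d -> (forall t, Rabs (t - x) < d -> Rabs (f t - f x) <= K * Rabs (t - x)) ->
  continuous f x.
Proof.
  intros Hd H. apply (filterlim_locally f (f x)). intros [eps He].
  assert (HK := Rabs_pos K).
  assert (Hm : 0 < Rmin d (eps / (Rabs K + 1))).
  { apply Rmin_pos; [assumption | apply Rdiv_lt_0_compat; lra]. }
  exists (mkposreal _ Hm). intros t Ht.
  change (Rabs (t - x) < Rmin d (eps / (Rabs K + 1))) in Ht.
  change (Rabs (f t - f x) < eps).
  assert (H1 := Rlt_le_trans _ _ _ Ht (Rmin_l _ _)).
  assert (H2 := Rlt_le_trans _ _ _ Ht (Rmin_r _ _)).
  eapply Rle_lt_trans; [apply H, H1|].
  apply (Rmult_lt_compat_l (Rabs K + 1)) in H2; [|lra].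
  replace ((Rabs K + 1) * (eps / (Rabs K + 1))) with eps in H2 by (field; lra).
  assert (H3 := Rle_abs K). assert (H4 := Rabs_pos (t - x)). nra.
Qed.

(** Turns a first-order expansion with slope [k] into a Lipschitz bound. *)
Lemma Rabs_affine_bound (u v k r e : R) :
  Rabs (u - (v + k * r)) <= e * Rabs r -> Rabs (u - v) <= (e + Rabs k) * Rabs r.
Proof.
  intros H. replace (u - v) with ((u - (v + k * r)) + k * r) by ring.
  eapply Rle_trans; [apply Rabs_triang|]. rewrite (Rabs_mult k r). lra.
Qed.

Lemma closed_form_continuous (P Q : R -> R -> R) (x y : R) : closed_form P Q ->
  continuous (fun t => P t y) x /\ continuous (fun t => Q x t) y.
Proof.
  intros H. destruct (H x y) as [p [k [q Hpq]]].
  destruct (Hpq 1 Rlt_0_1) as [d [Hd K]].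
  split.
  - apply (continuous_of_Lipschitz_at _ _ (1 + Rabs p) d Hd). intros t Ht.
    apply Rabs_affine_bound.
    destruct (K t y Ht) as [K1 _]; [rewrite Rminus_diag, Rabs_R0; exact Hd|].
    rewrite (Rminus_diag y), Rabs_R0, Rmult_0_r, !Rplus_0_r in K1. exact K1.
  - apply (continuous_of_Lipschitz_at _ _ (1 + Rabs q) d Hd). intros t Ht.
    apply Rabs_affine_bound.
    destruct (K x t) as [_ K2]; [rewrite Rminus_diag, Rabs_R0; exact Hd | exact Ht |].
    rewrite (Rminus_diag x), Rabs_R0, Rmult_0_r, Rplus_0_r, Rplus_0_l in K2. exact K2.
Qed.

Lemma closed_form_ex_RInt (P Q : R -> R -> R) (a b c d : R) : closed_form P Q ->
  ex_RInt (fun x => P x c - P x d) a b /\ ex_RInt (fun y => Q b y - Q a y) c d.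
Proof.
  intros H; split; apply (@ex_RInt_continuous R_CompleteNormedModule); intros z _.
  - apply (continuous_minus (fun x => P x c) (fun x => P x d));
      apply (closed_form_continuous P Q); assumption.
  - apply (continuous_minus (fun y => Q b y) (fun y => Q a y));
      apply (closed_form_continuous P Q); assumption.
Qed.

Lemma circulation_split_x (P Q : R -> R -> R) (a m b c d : R) : closed_form P Q ->
  circulation P Q a b c d = circulation P Q a m c d + circulation P Q m b c d.
Proof.
  intros H. unfold circulation.
  rewrite <- (RInt_Chasles (fun x => P x c - P x d) a m b) by
    apply (closed_form_ex_RInt P Q _ _ c d H).
  replace (RInt (fun y => Q b y - Q a y) c d) with
    (RInt (fun y => Q m y - Q a y) c d + RInt (fun y => Q b y - Q m y) c d).
  - change plus with Rplus. ring.
  - rewrite <- (RInt_plus (fun y => Q m y - Q a y) (fun y => Q b y - Q m y)) by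
      apply (closed_form_ex_RInt P Q _ _ c d H).
    apply RInt_ext. intros y _. change plus with Rplus. simpl. ring.
Qed.

Lemma circulation_split_y (P Q : R -> R -> R) (a b c m d : R) : closed_form P Q ->
  circulation P Q a b c d = circulation P Q a b c m + circulation P Q a b m d.
Proof.
  intros H. unfold circulation.
  rewrite <- (RInt_Chasles (fun y => Q b y - Q a y) c m d) by
    apply (closed_form_ex_RInt P Q a b _ _ H).
  replace (RInt (fun x => P x c - P x d) a b) with
    (RInt (fun x => P x c - P x m) a b + RInt (fun x => P x m - P x d) a b).
  - change plus with Rplus. ring.
  - rewrite <- (RInt_plus (fun x => P x c - P x m) (fun x => P x m - P x d)) by
      apply (closed_form_ex_RInt P Q a b _ _ H).
    apply RInt_ext. intros x _. change plus with Rplus. simpl. ring.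
Qed.

(** The bisection step: the circulation is the sum of those of the four
    quarters, so one quarter carries at least a fourth of it. *)
Lemma circulation_quarter (P Q : R -> R -> R) (a c l m : R) : closed_form P Q ->
  exists a' c', (a' = a \/ a' = a + l) /\ (c' = c \/ c' = c + m) /\
  Rabs (circulation P Q a (a + 2 * l) c (c + 2 * m))
    <= 4 * Rabs (circulation P Q a' (a' + l) c' (c' + m)).
Proof.
  intros H.
  set (J a' c' := circulation P Q a' (a' + l) c' (c' + m)).
  assert (E : circulation P Q a (a + 2 * l) c (c + 2 * m)
    = J a c + J (a + l) c + (J a (c + m) + J (a + l) (c + m))).
  { unfold J. rewrite (circulation_split_y P Q _ _ _ (c + m)) by assumption.
    rewrite !(circulation_split_x P Q a (a + l) (a + 2 * l)) by assumption.
    replace (a + l + l) with (a + 2 * l) by ring.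
    replace (c + m + m) with (c + 2 * m) by ring. reflexivity. }
  rewrite E.
  assert (T : Rabs (J a c + J (a + l) c + (J a (c + m) + J (a + l) (c + m))) <=
     Rabs (J a c) + Rabs (J (a + l) c) + (Rabs (J a (c + m)) + Rabs (J (a + l) (c + m)))).
  { eapply Rle_trans; [apply Rabs_triang|]. apply Rplus_le_compat; apply Rabs_triang. }
  set (S := J a c + J (a + l) c + (J a (c + m) + J (a + l) (c + m))) in *.
  destruct (Rle_dec (Rabs S) (4 * Rabs (J a c))); [exists a, c; tauto|].
  destruct (Rle_dec (Rabs S) (4 * Rabs (J (a + l) c))); [exists (a + l), c; tauto|].
  destruct (Rle_dec (Rabs S) (4 * Rabs (J a (c + m)))); [exists a, (c + m); tauto|].
  exists (a + l), (c + m). split; [tauto|]. split; [tauto|]. fold (J (a + l) (c + m)). lra.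
Qed.

(** Near a point of differentiability the two integrands are - k m and k l up to
    small errors, over intervals of lengths l and m, so their integrals cancel: this
    is where the closedness condition enters.  The error is quadratic in the size,
    as needed to beat the factor 4 of each bisection. *)
Lemma circulation_small (P Q : R -> R -> R) (x0 y0 k q p eps r a c l m : R) :
  closed_form P Q -> 0 < eps ->
  (forall x y, Rabs (x - x0) < r -> Rabs (y - y0) < r ->
    Rabs (P x y - (P x0 y0 + p * (x - x0) + k * (y - y0)))
      <= eps * (Rabs (x - x0) + Rabs (y - y0)) /\
    Rabs (Q x y - (Q x0 y0 + k * (x - x0) + q * (y - y0)))
      <= eps * (Rabs (x - x0) + Rabs (y - y0))) ->
  0 <= l < r -> 0 <= m < r -> a <= x0 <= a + l -> c <= y0 <= c + m ->
  Rabs (circulation P Q a (a + l) c (c + m)) <= 2 * eps * (l + m) ^ 2.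
Proof.
  intros H He K Hl Hm Hx Hy. unfold circulation.
  assert (K' : forall x y, a <= x <= a + l -> c <= y <= c + m ->
    Rabs (P x y - (P x0 y0 + p * (x - x0) + k * (y - y0))) <= eps * (l + m) /\
    Rabs (Q x y - (Q x0 y0 + k * (x - x0) + q * (y - y0))) <= eps * (l + m)).
  { intros x y Hx' Hy'.
    assert (Rabs (x - x0) <= l) by (apply Rabs_le; lra).
    assert (Rabs (y - y0) <= m) by (apply Rabs_le; lra).
    destruct (K x y) as [K1 K2]; [lra | lra |].
    assert (eps * (Rabs (x - x0) + Rabs (y - y0)) <= eps * (l + m))
      by (apply Rmult_le_compat_l; lra).
    lra. }
  destruct (closed_form_ex_RInt P Q a (a + l) c (c + m) H) as [E1 E2].
  assert (I1 : is_RInt (fun x => minus (P x c - P x (c + m)) (- (k * m))) a (a + l)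
     (minus (RInt (fun x => P x c - P x (c + m)) a (a + l)) (scal (a + l - a) (- (k * m))))).
  { apply (is_RInt_minus (fun x => P x c - P x (c + m)) (fun _ => - (k * m))).
    - apply (@RInt_correct R_CompleteNormedModule), E1.
    - apply (@is_RInt_const R_NormedModule). }
  assert (I2 : is_RInt (fun y => minus (Q (a + l) y - Q a y) (k * l)) c (c + m)
     (minus (RInt (fun y => Q (a + l) y - Q a y) c (c + m)) (scal (c + m - c) (k * l)))).
  { apply (is_RInt_minus (fun y => Q (a + l) y - Q a y) (fun _ => k * l)).
    - apply (@RInt_correct R_CompleteNormedModule), E2.
    - apply (@is_RInt_const R_NormedModule). }
  apply (norm_RInt_le_const _ _ _ _ (2 * (eps * (l + m)))) in I1; [| lra |].
  apply (norm_RInt_le_const _ _ _ _ (2 * (eps * (l + m)))) in I2; [| lra |].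
  - set (R1 := RInt _ a _) in *. set (R2 := RInt _ c _) in *.
    change (Rabs (R1 - (a + l - a) * - (k * m)) <= (a + l - a) * (2 * (eps * (l + m)))) in I1.
    change (Rabs (R2 - (c + m - c) * (k * l)) <= (c + m - c) * (2 * (eps * (l + m)))) in I2.
    replace (R1 + R2) with ((R1 - (a + l - a) * - (k * m)) + (R2 - (c + m - c) * (k * l))) by ring.
    eapply Rle_trans; [apply Rabs_triang|]. nra.
  - intros y Hy'.
    change (Rabs (Q (a + l) y - Q a y - k * l) <= 2 * (eps * (l + m))).
    destruct (K' (a + l) y) as [_ L1]; [lra | lra |].
    destruct (K' a y) as [_ L2]; [lra | lra |].
    apply Rabs_le_between in L1, L2. apply Rabs_le. lra.
  - intros x Hx'.
    change (Rabs (P x c - P x (c + m) - - (k * m)) <= 2 * (eps * (l + m))).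
    destruct (K' x c) as [L1 _]; [lra | lra |].
    destruct (K' x (c + m)) as [L2 _]; [lra | lra |].
    apply Rabs_le_between in L1, L2. apply Rabs_le. lra.
Qed.

Lemma nested_intervals (a : nat -> R) (l : R) : 0 <= l ->
  (forall n, a (S n) = a n \/ a (S n) = a n + l / 2 ^ S n) ->
  exists x, forall n, a n <= x <= a n + l / 2 ^ n.
Proof.
  intros Hl H.
  assert (Hpos : forall n, 0 <= l / 2 ^ n).
  { intros n. apply Rdiv_le_0_compat; [exact Hl | apply pow_lt; lra]. }
  assert (Hhalf : forall n, l / 2 ^ n = 2 * (l / 2 ^ S n)).
  { intros n. simpl. field. apply pow_nonzero; lra. }
  assert (Hi : forall n, a n <= a (S n)).
  { intros n. specialize (Hpos (S n)). destruct (H n); lra. }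
  assert (Hd : forall n, a (S n) + l / 2 ^ S n <= a n + l / 2 ^ n).
  { intros n. rewrite (Hhalf n). specialize (Hpos (S n)). destruct (H n); lra. }
  assert (Hle : forall n k, a n <= a (k + n)%nat /\ a (k + n)%nat + l / 2 ^ (k + n) <= a n + l / 2 ^ n).
  { intros n k; induction k as [|k [IH1 IH2]]; [change (0 + n)%nat with n; lra|].
    change (S k + n)%nat with (S (k + n)).
    specialize (Hi (k + n)%nat). specialize (Hd (k + n)%nat). lra. }
  destruct (ex_finite_lim_seq_incr a (a 0%nat + l)) as [x Hx].
  - exact Hi.
  - intros n. destruct (Hle 0%nat n) as [_ X]. rewrite Nat.add_0_r in X.
    specialize (Hpos n). replace (l / 2 ^ 0) with l in X by (simpl; field). lra.
  - exists x. intros n. split.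
    + apply (is_lim_seq_incr_compare a x Hx Hi).
    + apply (is_lim_seq_incr_n a n) in Hx.
      apply (is_lim_seq_le (fun k => a (k + n)%nat) (fun _ => a n + l / 2 ^ n) x (a n + l / 2 ^ n)).
      * intros k. destruct (Hle n k). specialize (Hpos (k + n)%nat). lra.
      * exact Hx.
      * apply is_lim_seq_const.
Qed.

Lemma pow_half_small (D e : R) : 0 < e -> exists n, D / 2 ^ n < e.
Proof.
  intros He.
  destruct (pow_lt_1_zero (/ 2)) with (y := e / (Rabs D + 1)) as [n Hn].
  - rewrite Rabs_pos_eq; lra.
  - apply Rdiv_lt_0_compat; [exact He | assert (X := Rabs_pos D); lra].
  - exists n. specialize (Hn n (le_n n)).
    assert (X := Rabs_pos D).
    rewrite Rabs_pos_eq in Hn by (apply pow_le; lra).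
    apply (Rmult_lt_compat_l (Rabs D + 1)) in Hn; [|lra].
    replace ((Rabs D + 1) * (e / (Rabs D + 1))) with e in Hn by (field; lra).
    rewrite pow_inv in Hn. unfold Rdiv.
    assert (0 < / 2 ^ n) by (apply Rinv_0_lt_compat, pow_lt; lra).
    assert (Y := Rle_abs D). nra.
Qed.

(** Bisecting forever gives rectangles shrinking to a point (x0, y0), each
    carrying a fraction 4^-n of the circulation, whereas by differentiability at
    (x0, y0) the n-th one carries at most eps * O(4^-n). *)
Lemma Goursat_closed_form (P Q : R -> R -> R) (a c l m : R) :
  closed_form P Q -> 0 <= l -> 0 <= m -> circulation P Q a (a + l) c (c + m) = 0.
Proof.
  intros H Hl Hm.
  assert (St : forall (n : nat) (st : R * R), exists st' : R * R,
    (fst st' = fst st \/ fst st' = fst st + l / 2 ^ S n) /\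
    (snd st' = snd st \/ snd st' = snd st + m / 2 ^ S n) /\
    Rabs (circulation P Q (fst st) (fst st + l / 2 ^ n) (snd st) (snd st + m / 2 ^ n))
    <= 4 * Rabs (circulation P Q (fst st') (fst st' + l / 2 ^ S n) (snd st') (snd st' + m / 2 ^ S n))).
  { intros n [a0 c0].
    destruct (circulation_quarter P Q a0 c0 (l / 2 ^ S n) (m / 2 ^ S n) H) as [a' [c' [Ha [Hc X]]]].
    exists (a', c'). simpl fst; simpl snd. split; [exact Ha|]. split; [exact Hc|].
    replace (l / 2 ^ n) with (2 * (l / 2 ^ S n)) by (simpl; field; apply pow_nonzero; lra).
    replace (m / 2 ^ n) with (2 * (m / 2 ^ S n)) by (simpl; field; apply pow_nonzero; lra).
    exact X. }
  set (next n st := proj1_sig (constructive_indefinite_description _ (St n st))).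
  (* Lower left corner of the n-th rectangle, whose sides are l / 2^n and m / 2^n. *)
  set (sq := fix sq n := match n with O => (a, c) | S n => next n (sq n) end).
  assert (Hsq : forall n, _) by
    exact (fun n => proj2_sig (constructive_indefinite_description _ (St n (sq n)))).
  simpl in Hsq.
  change (forall n, (fst (sq (S n)) = fst (sq n) \/ fst (sq (S n)) = fst (sq n) + l / 2 ^ S n) /\
    (snd (sq (S n)) = snd (sq n) \/ snd (sq (S n)) = snd (sq n) + m / 2 ^ S n) /\
    Rabs (circulation P Q (fst (sq n)) (fst (sq n) + l / 2 ^ n) (snd (sq n)) (snd (sq n) + m / 2 ^ n))
    <= 4 * Rabs (circulation P Q (fst (sq (S n))) (fst (sq (S n)) + l / 2 ^ S n)
        (snd (sq (S n))) (snd (sq (S n)) + m / 2 ^ S n))) in Hsq.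
  destruct (nested_intervals (fun n => fst (sq n)) l Hl) as [x0 Hx0]; [intros n; apply Hsq|].
  destruct (nested_intervals (fun n => snd (sq n)) m Hm) as [y0 Hy0]; [intros n; apply Hsq|].
  assert (Hn : forall n, Rabs (circulation P Q a (a + l) c (c + m)) <=
    4 ^ n * Rabs (circulation P Q (fst (sq n)) (fst (sq n) + l / 2 ^ n)
                               (snd (sq n)) (snd (sq n) + m / 2 ^ n))).
  { induction n as [|n IH].
    - simpl. unfold Rdiv. rewrite Rinv_1, !Rmult_1_r, Rmult_1_l. lra.
    - eapply Rle_trans; [exact IH|]. destruct (Hsq n) as [_ [_ X]].
      change (4 ^ S n) with (4 * 4 ^ n).
      assert (0 < 4 ^ n) by (apply pow_lt; lra). nra. }
  apply Rabs_eq_0, Rle_antisym; [|apply Rabs_pos].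
  apply le_epsilon. intros e He. rewrite Rplus_0_l.
  assert (HD : 0 <= (l + m) ^ 2) by nra.
  (* The bound of [circulation_small], multiplied by 4^n, is 2 eps (l + m)^2 for
     every n; this choice of eps makes it smaller than e. *)
  assert (He' : 0 < e / (2 * (l + m) ^ 2 + 1)) by (apply Rdiv_lt_0_compat; lra).
  destruct (H x0 y0) as [p [k [q Hpq]]].
  destruct (Hpq _ He') as [r [Hr K]].
  destruct (pow_half_small (l + m) r Hr) as [n Hnr].
  assert (H2n : 0 < 2 ^ n) by (apply pow_lt; lra).
  assert (Hlm : (l + m) / 2 ^ n = l / 2 ^ n + m / 2 ^ n) by (field; lra).
  assert (0 <= l / 2 ^ n) by (apply Rdiv_le_0_compat; lra).
  assert (0 <= m / 2 ^ n) by (apply Rdiv_le_0_compat; lra).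
  assert (X := circulation_small P Q x0 y0 k q p _ r (fst (sq n)) (snd (sq n))
    (l / 2 ^ n) (m / 2 ^ n) H He' K).
  eapply Rle_trans; [apply (Hn n)|].
  eapply Rle_trans; [apply Rmult_le_compat_l; [apply pow_le; lra|]; apply X|].
  - lra.
  - lra.
  - apply Hx0.
  - apply Hy0.
  - rewrite <- Hlm.
    replace (4 ^ n) with (2 ^ n * 2 ^ n) by (rewrite <- Rpow_mult_distr; f_equal; ring).
    replace (2 ^ n * 2 ^ n * (2 * (e / (2 * (l + m) ^ 2 + 1)) * ((l + m) / 2 ^ n) ^ 2))
      with (e - e / (2 * (l + m) ^ 2 + 1)) by (field; lra).
    lra.
Qed.

(** * Entire functions vanishing on a half-plane *)

(** The complex numbers carry two normed-module structures over themselves.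
    The chain and product rules need the one coming from the ring. *)
Lemma C_is_derive_AbsRing (f : C -> C) (s l : C) :
  @is_derive C_AbsRing C_NormedModule f s l <->
  @is_derive C_AbsRing (AbsRing_NormedModule C_AbsRing) f s l.
Proof.
  split; intros [_ H]; (split; [apply @is_linear_scal_l | exact H]).
Qed.

Lemma entire_comp (f g : C -> C) : entire f -> entire g -> entire (fun z => f (g z)).
Proof.
  intros Hf Hg s. destruct (Hg s) as [dg Hdg]. destruct (Hf (g s)) as [df Hdf].
  exists (scal dg df).
  exact (@is_derive_comp C_AbsRing C_NormedModule f g s df dg Hdf
    (proj1 (C_is_derive_AbsRing _ _ _) Hdg)).
Qed.

Lemma entire_mult (f g : C -> C) : entire f -> entire g -> entire (fun z => f z * g z)%C.
Proof.
  intros Hf Hg s. destruct (Hg s) as [dg Hdg]. destruct (Hf s) as [df Hdf].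
  eexists. apply C_is_derive_AbsRing.
  apply (@is_derive_mult C_AbsRing f g s df dg); [apply C_is_derive_AbsRing, Hdf
    | apply C_is_derive_AbsRing, Hdg | exact Cmult_comm].
Qed.

Lemma entire_affine (a b : C) : entire (fun z => a + b * z)%C.
Proof.
  intros s. exists b. apply C_is_derive_eps. intros eps He. exists 1. split; [lra|].
  intros w _. replace (_ - _)%C with (RtoC 0) by ring. rewrite Cmod_0.
  apply Rmult_le_pos; [lra | apply Cmod_ge_0].
Qed.

Lemma entire_minus (f g : C -> C) : entire f -> entire g -> entire (fun z => f z - g z)%C.
Proof.
  intros Hf Hg s. destruct (Hg s) as [dg Hdg]. destruct (Hf s) as [df Hdf].
  eexists. exact (@is_derive_minus C_AbsRing C_NormedModule f g s df dg Hdf Hdg).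
Qed.

Lemma entire_Cexp : entire Cexp.
Proof. intros s. eexists. apply is_derive_Cexp. Qed.

(** The form Im h dx + Re h dy is the imaginary part of h dz; its closedness is
    one of the Cauchy-Riemann equations. *)
Lemma entire_closed_form (h : C -> C) : entire h ->
  closed_form (fun x y => Im (h (x, y))) (fun x y => Re (h (x, y))).
Proof.
  intros H x0 y0. destruct (H (x0, y0)) as [[a b] Hd].
  exists b, a, (- b). intros eps He.
  destruct (proj1 (C_is_derive_eps _ _ _) Hd eps He) as [d [Hd0 K]].
  exists (d / 2). split; [lra|]. intros x y Hx Hy.
  set (w := (x - x0, y - y0) : C).
  assert (Hw : Cmod w <= Rabs (x - x0) + Rabs (y - y0)) by apply (Cmod_le_Re_Im w).
  specialize (K w ltac:(lra)).
  replace ((x0, y0) + w)%C with ((x, y) : C) in K by (unfold w, Cplus; simpl; f_equal; ring).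
  assert (E : eps * Cmod w <= eps * (Rabs (x - x0) + Rabs (y - y0)))
    by (apply Rmult_le_compat_l; lra).
  assert (K1 := im_le_Cmod (h (x, y) - h (x0, y0) - w * (a, b))%C).
  assert (K2 := re_le_Cmod (h (x, y) - h (x0, y0) - w * (a, b))%C).
  simpl in K1, K2.
  split.
  - eapply Rle_trans; [|exact E]. eapply Rle_trans; [|exact K].
    eapply Rle_trans; [|exact K1]. apply Req_le. f_equal. unfold Im. ring.
  - eapply Rle_trans; [|exact E]. eapply Rle_trans; [|exact K].
    eapply Rle_trans; [|exact K2]. apply Req_le. f_equal. unfold Re. ring.
Qed.

(** In the coordinate z = e^w the circle of radius e^x becomes a vertical
    segment of length 2 pi.  On the rectangle [a, b] x [0, 2 pi] the horizontal sides
    cancel by periodicity, so the integrals over the vertical sides agree: the right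
    one is 0 because F vanishes there, the left one is close to
    2 pi Re F(0) because e^a is small. *)
Lemma entire_compact_support_Re (F : C -> C) (r : R) :
  entire F -> (forall z, r < Cmod z -> F z = 0%C) -> Re (F 0%C) = 0.
Proof.
  intros HF Hr.
  assert (Hh := entire_closed_form _ (entire_comp F Cexp HF entire_Cexp)).
  apply Rabs_eq_0, Rle_antisym; [|apply Rabs_pos].
  apply le_epsilon. intros e He. rewrite Rplus_0_l.
  destruct (HF 0%C) as [l Hl].
  destruct (proj1 (C_is_derive_eps _ _ _) Hl 1 Rlt_0_1) as [d [Hd K]].
  assert (Hlm := Cmod_ge_0 l).
  (* In the disc of radius m around 0, [F] differs from [F 0] by less than e. *)
  set (m := Rmin d (e / (1 + Cmod l))).
  assert (Hm : 0 < m) by (apply Rmin_pos; [lra | apply Rdiv_lt_0_compat; lra]).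
  set (b := ln (Rabs r + 1)). set (a := Rmin (ln (m / 2)) b).
  assert (Hr1 : 0 < Rabs r + 1) by (assert (X := Rabs_pos r); lra).
  assert (Ea : exp a < m).
  { apply Rle_lt_trans with (m / 2); [|lra].
    rewrite <- (exp_ln (m / 2)) by lra. unfold a.
    destruct (Rmin_l (ln (m / 2)) b) as [X | ->]; [left; apply exp_increasing, X | right; reflexivity]. }
  assert (Hab : 0 <= b - a) by (assert (X := Rmin_r (ln (m / 2)) b); unfold a; lra).
  assert (HPI := PI_RGT_0).
  assert (G := Goursat_closed_form _ _ a 0 (b - a) (2 * PI) Hh Hab ltac:(lra)).
  unfold circulation in G.
  rewrite (RInt_ext _ (fun _ => 0)) in G.
  2: { intros x _. replace (Cexp (x, 0 + 2 * PI)) with (Cexp (x, 0)); [apply Rminus_diag|].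
       rewrite Rplus_0_l. unfold Cexp, Re, Im. simpl fst; simpl snd.
       rewrite sin_0, cos_0, sin_2PI, cos_2PI. reflexivity. }
  rewrite RInt_const in G.
  destruct (closed_form_ex_RInt _ _ a (a + (b - a)) 0 (0 + 2 * PI) Hh) as [_ I].
  apply (@RInt_correct R_CompleteNormedModule) in I.
  assert (J := is_RInt_plus _ _ _ _ _ _ I
     (@is_RInt_const R_NormedModule 0 (0 + 2 * PI) (Re (F 0%C)))).
  apply (norm_RInt_le_const _ _ _ _ e) in J; [|lra|].
  - set (R1 := RInt _ 0 (0 + _)) in *.
    change ((a + (b - a) - a) * 0 + R1 = 0) in G.
    change (Rabs (R1 + (0 + 2 * PI - 0) * Re (F 0%C)) <= (0 + 2 * PI - 0) * e) in J.
    replace R1 with 0 in J by lra.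
    replace (0 + (0 + 2 * PI - 0) * Re (F 0%C)) with (2 * PI * Re (F 0%C)) in J by ring.
    rewrite Rabs_mult, (Rabs_pos_eq (2 * PI)) in J by lra.
    apply Rmult_le_reg_l with (2 * PI); lra.
  - intros y _.
    change (Rabs (Re (F (Cexp (a + (b - a), y))) - Re (F (Cexp (a, y))) + Re (F 0%C)) <= e).
    rewrite (Hr (Cexp (a + (b - a), y))).
    2: { rewrite Cmod_Cexp. simpl. replace (a + (b - a)) with b by ring.
         unfold b. rewrite exp_ln by assumption. assert (X := Rle_abs r). lra. }
    set (w := Cexp (a, y)).
    assert (Hw : Cmod w < m) by (unfold w; rewrite Cmod_Cexp; exact Ea).
    assert (Hw1 := Rlt_le_trans _ _ _ Hw (Rmin_l _ _)).
    assert (Hw2 := Rlt_le_trans _ _ _ Hw (Rmin_r _ _)).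
    specialize (K w Hw1). rewrite Cplus_0_l in K.
    replace (Re 0%C - Re (F w) + Re (F 0%C)) with (- Re (F w - F 0%C)%C) by (simpl; unfold Re; ring).
    rewrite Rabs_Ropp. eapply Rle_trans; [apply re_le_Cmod|].
    replace (F w - F 0)%C with ((F w - F 0 - w * l) + w * l)%C by ring.
    eapply Rle_trans; [apply Cmod_triangle|]. rewrite Cmod_mult.
    apply (Rmult_lt_compat_l (1 + Cmod l)) in Hw2; [|lra].
    replace ((1 + Cmod l) * (e / (1 + Cmod l))) with e in Hw2 by (field; lra). lra.
Qed.

(** The imaginary part of F is the real part of - i F. *)
Lemma entire_compact_support (F : C -> C) (r : R) :
  entire F -> (forall z, r < Cmod z -> F z = 0%C) -> F 0%C = 0%C.
Proof.
  intros HF Hr.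
  assert (H1 := entire_compact_support_Re F r HF Hr).
  assert (H2 := entire_compact_support_Re (fun z => 0 + - Ci * F z)%C r
    (entire_comp (fun z => 0 + - Ci * z)%C F (entire_affine 0 (- Ci)) HF)).
  assert (H3 : Re (0 + - Ci * F 0)%C = 0).
  { apply H2. intros z Hz. rewrite Hr by assumption. ring. }
  destruct (F 0%C) as [x y]. simpl in H1, H3. unfold RtoC. f_equal; lra.
Qed.

(** When |z| > 2 |Re s|, one of z, iz, -z, -iz has real part larger than |Re s|,
    so one of the four factors of [F z] below vanishes. *)
Lemma entire_zero_of_half_plane (g : C -> C) :
  entire g -> (forall s, 0 < Re s -> g s = 0%C) -> forall s, g s = 0%C.
Proof.
  intros Hg H0 s.
  set (F z := (g (s + 1 * z) * g (s + Ci * z) * (g (s + (-(1)) * z) * g (s + (- Ci) * z)))%C).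
  assert (HF : entire F).
  { unfold F. repeat apply entire_mult;
      apply (entire_comp g (fun z => s + _ * z)%C Hg), entire_affine. }
  assert (E : F 0%C = 0%C).
  { apply (entire_compact_support F (2 * Rabs (Re s)) HF).
    intros z Hz. unfold F.
    assert (Z := Cmod_le_Re_Im z). assert (S1 := Rle_abs (- Re s)). rewrite Rabs_Ropp in S1.
    assert (D : Rabs (Re s) < Rabs (Re z) \/ Rabs (Re s) < Rabs (Im z)) by lra.
    assert (D' : 0 < Re (s + 1 * z)%C \/ 0 < Re (s + Ci * z)%C \/
      0 < Re (s + (-(1)) * z)%C \/ 0 < Re (s + (- Ci) * z)%C).
    { destruct s as [s1 s2], z as [x y]. simpl in *. unfold Re, Im in *. simpl in *.
      destruct D as [D | D]; [destruct (Rle_dec 0 x) | destruct (Rle_dec 0 y)].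
      - left. rewrite (Rabs_pos_eq x) in D by assumption. lra.
      - right; right; left. rewrite (Rabs_left x) in D by lra. lra.
      - right; right; right. rewrite (Rabs_pos_eq y) in D by assumption. lra.
      - right; left. rewrite (Rabs_left y) in D by lra. lra. }
    destruct D' as [D' | [D' | [D' | D']]]; rewrite (H0 _ D'); ring. }
  unfold F in E. replace (s + 1 * 0)%C with s in E by ring.
  replace (s + Ci * 0)%C with s in E by ring.
  replace (s + - (1) * 0)%C with s in E by ring.
  replace (s + - Ci * 0)%C with s in E by ring.
  destruct (excluded_middle_informative (g s = 0%C)) as [|N]; [assumption|].
  exfalso. revert E. repeat apply Cmult_neq_0; assumption.
Qed.

Lemma is_zetaE_unique (f g : C -> C) : is_zetaE f -> is_zetaE g -> forall s, f s = g s.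
Proof.
  intros [Hf Sf] [Hg Sg] s. apply Ceq_minus.
  apply (entire_zero_of_half_plane (fun z => f z - g z)%C (entire_minus f g Hf Hg)).
  intros z Hz. apply (proj1 (Ceq_minus (f z) (g z))).
  exact (@filterlim_locally_unique _ C_AbsRing C_NormedModule eventually _ _ _ _ (Sf z Hz) (Sg z Hz)).
Qed.

(** * Iterated differences of logarithms times powers *)

(** The power x^-q. *)
Definition Rpow_neg (q : C) (x : R) : C := Cexp (- q * RtoC (ln x)).

(** This class of functions is stable under differentiation in x, and contains the
    first two derivatives of x^-s in s; the logarithms come from the latter. *)
Definition log_power (c0 c1 c2 q : C) (x : R) : C :=
  ((c0 + c1 * RtoC (ln x) + c2 * (RtoC (ln x) * RtoC (ln x))) * Rpow_neg q x)%C.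

Lemma Rpow_neg_succ (q : C) (x : R) : 0 < x ->
  Rpow_neg (q + 1) x = (RtoC (/ x) * Rpow_neg q x)%C.
Proof.
  intros Hx. unfold Rpow_neg.
  replace (- (q + 1) * RtoC (ln x))%C with (RtoC (- ln x) + - q * RtoC (ln x))%C
    by (rewrite RtoC_opp; ring).
  rewrite Cexp_plus, Cexp_RtoC, exp_Ropp, exp_ln by assumption. reflexivity.
Qed.

Lemma is_Rderive_ln (x : R) : 0 < x -> is_Rderive (fun t => RtoC (ln t)) x (RtoC (/ x)).
Proof. intros Hx. apply is_Rderive_RtoC, is_derive_Reals, derivable_pt_lim_ln, Hx. Qed.

Lemma is_Rderive_log_power (c0 c1 c2 q : C) (x : R) : 0 < x ->
  is_Rderive (log_power c0 c1 c2 q) x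
    (log_power (c1 - q * c0) (2 * c2 - q * c1) (- q * c2) (q + 1) x).
Proof.
  intros Hx. assert (HL := is_Rderive_ln x Hx).
  eapply is_Rderive_eq.
  - apply is_Rderive_mult.
    + apply is_Rderive_plus.
      * apply is_Rderive_plus; [apply is_Rderive_const | apply is_Rderive_scal, HL].
      * apply is_Rderive_scal, is_Rderive_mult; exact HL.
    + apply is_Rderive_Cexp, is_Rderive_scal, HL.
  - cbv beta. unfold log_power. rewrite Rpow_neg_succ by assumption.
    unfold Rpow_neg. ring.
Qed.

Lemma is_Rderive_log_power_exponent (c0 c1 c2 s w : C) (x t : R) :
  is_Rderive (fun t => log_power c0 c1 c2 (s + RtoC t * w) x)%C t
    (w * (- RtoC (ln x) * log_power c0 c1 c2 (s + RtoC t * w) x))%C.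
Proof.
  eapply is_Rderive_eq.
  - apply is_Rderive_scal.
    apply (is_Rderive_Cexp (fun t => - (s + RtoC t * w) * RtoC (ln x))%C t (- w * RtoC (ln x))%C).
    eapply is_Rderive_eq.
    + apply is_Rderive_mult; [|apply is_Rderive_const].
      eapply (is_Rderive_eq (fun t => - (s + RtoC t * w))%C t _ (- w)%C).
      * assert (X := is_Rderive_scal (-(1))%C _ _ _ (is_Rderive_line s w t)).
        destruct X as [X1 X2].
        split; [revert X1 | revert X2]; apply is_derive_ext; intros u; simpl; ring.
      * ring.
    + cbv beta. ring.
  - cbv beta. unfold log_power, Rpow_neg. ring.
Qed.

(** The sign convention f(x) - f(x + 1) is the one produced by averaging an
    alternating sum. *)
Fixpoint diff (k : nat) (f : R -> C) (x : R) : C :=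
  match k with
  | O => f x
  | S k => diff k f x - diff k f (x + 1)
  end%C.

Lemma is_Rderive_diff (f f' : R -> C) :
  (forall x, 0 < x -> is_Rderive f x (f' x)) ->
  forall k x, 0 < x -> is_Rderive (diff k f) x (diff k f' x).
Proof.
  intros H; induction k as [|k IH]; intros x Hx; simpl; [apply H, Hx|].
  apply is_Rderive_minus; [apply IH, Hx|].
  apply (is_Rderive_shift (diff k f)), IH. lra.
Qed.

(** The logarithmic factor is at most 3 M x^2 and x^-q at most x^-4. *)
Lemma Cmod_log_power_le (c0 c1 c2 q : C) (M x : R) :
  Cmod c0 <= M -> Cmod c1 <= M -> Cmod c2 <= M -> 4 <= Re q -> 1 <= x ->
  Cmod (log_power c0 c1 c2 q x) <= 3 * M / x ^ 2.
Proof.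
  intros H0 H1 H2 Hq Hx.
  assert (HM := Rle_trans _ _ _ (Cmod_ge_0 c0) H0).
  assert (HL0 : 0 <= ln x) by (rewrite <- ln_1; apply ln_le; lra).
  assert (HL1 : ln x <= x).
  { left. rewrite <- (ln_exp x) at 2. apply ln_increasing; [lra|].
    assert (X := exp_ineq1 x ltac:(lra)). lra. }
  unfold log_power. rewrite Cmod_mult.
  apply Rle_trans with ((3 * M * x ^ 2) * / x ^ 4).
  - apply Rmult_le_compat; try apply Cmod_ge_0.
    + eapply Rle_trans; [apply Cmod_triangle|].
      eapply Rle_trans; [apply Rplus_le_compat_r, Cmod_triangle|].
      rewrite !Cmod_mult, !Cmod_R, !(Rabs_pos_eq (ln x)) by assumption.
      assert (Cmod c1 * ln x <= M * x) by (apply Rmult_le_compat; auto; apply Cmod_ge_0).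
      assert (Cmod c2 * (ln x * ln x) <= M * (x * x)).
      { apply Rmult_le_compat; auto; [apply Cmod_ge_0 | nra | nra]. }
      assert (1 <= x * x) by nra. assert (x <= x * x) by nra. nra.
    + unfold Rpow_neg. rewrite Cmod_Cexp.
      replace (/ x ^ 4) with (exp (- (4 * ln x))).
      * assert (X : Re (- q * RtoC (ln x)) <= - (4 * ln x)).
        { replace (Re (- q * RtoC (ln x))) with (- (Re q * ln x)) by (simpl; unfold Re; ring). nra. }
        destruct X as [X | ->]; [left; apply exp_increasing, X | right; reflexivity].
      * rewrite exp_Ropp. f_equal.
        replace (4 * ln x) with (INR 4 * ln x) by (simpl; ring).
        rewrite <- ln_pow by lra. apply exp_ln, pow_lt; lra.
  - apply Req_le. field. lra.
Qed.

(** Each difference costs a factor 2 from the mean value inequality and a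
    factor 2 + r from the coefficients of the derivative, whose exponent
    q + 1 has modulus at most r + 1. *)
Fixpoint diff_const (k : nat) (r : R) : R :=
  match k with O => 3 | S k => 2 * ((2 + r) * diff_const k (r + 1)) end.

Lemma diff_const_pos k : forall r, 0 <= r -> 0 < diff_const k r.
Proof.
  induction k as [|k IH]; intros r Hr; simpl; [lra|].
  specialize (IH (r + 1) ltac:(lra)). nra.
Qed.

(** A difference is controlled by a derivative, and differentiation raises the
    exponent by 1, so the sum of Re q and the order k is invariant in the induction. *)
Lemma diff_log_power_bound (k : nat) : forall (c0 c1 c2 q : C) (M r x : R),
  Cmod c0 <= M -> Cmod c1 <= M -> Cmod c2 <= M -> Cmod q <= r -> 4 <= Re q + INR k -> 1 <= x ->
  Cmod (diff k (log_power c0 c1 c2 q) x) <= diff_const k r * M / x ^ 2.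
Proof.
  induction k as [|k IH]; intros c0 c1 c2 q M r x H0 H1 H2 Hq Hk Hx.
  - apply Cmod_log_power_le; auto. simpl in Hk. lra.
  - assert (HM := Rle_trans _ _ _ (Cmod_ge_0 c0) H0).
    assert (Hr := Rle_trans _ _ _ (Cmod_ge_0 q) Hq).
    assert (HC := diff_const_pos k (r + 1) ltac:(lra)).
    assert (Hqc : forall c, Cmod c <= M -> Cmod (- q * c)%C <= r * M).
    { intros c Hc. rewrite Cmod_mult, Cmod_opp.
      apply Rmult_le_compat; auto; apply Cmod_ge_0. }
    rewrite S_INR in Hk.
    assert (X := is_Rderive_bound (diff k (log_power c0 c1 c2 q))
      (diff k (log_power (c1 - q * c0) (2 * c2 - q * c1) (- q * c2) (q + 1))) x (x + 1)
      (diff_const k (r + 1) * ((2 + r) * M) / x ^ 2) ltac:(lra)).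
    simpl diff. simpl diff_const.
    rewrite <- Cmod_opp.
    replace (- (diff k (log_power c0 c1 c2 q) x - diff k (log_power c0 c1 c2 q) (x + 1)))%C
      with (diff k (log_power c0 c1 c2 q) (x + 1) - diff k (log_power c0 c1 c2 q) x)%C by ring.
    eapply Rle_trans; [apply X|].
    + intros t Ht. apply is_Rderive_diff; [|lra]. intros y Hy. apply is_Rderive_log_power, Hy.
    + intros t Ht.
      eapply Rle_trans; [apply (IH _ _ _ _ ((2 + r) * M) (r + 1))|].
      * replace (c1 - q * c0)%C with (c1 + - q * c0)%C by ring.
        eapply Rle_trans; [apply Cmod_triangle|]. specialize (Hqc c0 H0). lra.
      * replace (2 * c2 - q * c1)%C with (2 * c2 + - q * c1)%C by ring.
        eapply Rle_trans; [apply Cmod_triangle|]. specialize (Hqc c1 H1).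
        rewrite Cmod_mult, Cmod_R, Rabs_pos_eq by lra. lra.
      * specialize (Hqc c2 H2). lra.
      * eapply Rle_trans; [apply Cmod_triangle|]. rewrite Cmod_1. lra.
      * replace (Re (q + 1)) with (Re q + 1) by reflexivity. lra.
      * lra.
      * unfold Rdiv. apply Rmult_le_compat_l; [repeat apply Rmult_le_pos; lra|].
        apply Rinv_le_contravar; [apply pow_lt; lra | apply pow_incr; lra].
    + apply Req_le. field. lra.
Qed.

(** * Complex limits and sequences with summable steps *)

(** Limits taken componentwise, so that the lemmas on real sequences apply. *)
Definition Clim (u : nat -> C) (l : C) : Prop :=
  is_lim_seq (fun n => Re (u n)) (Re l) /\ is_lim_seq (fun n => Im (u n)) (Im l).

Lemma Clim_unique u l m : Clim u l -> Clim u m -> l = m.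
Proof.
  intros [H1 H2] [H3 H4]. apply is_lim_seq_unique in H1, H2, H3, H4.
  rewrite H1 in H3. rewrite H2 in H4. injection H3; injection H4; intros.
  destruct l, m; simpl in *; congruence.
Qed.

Lemma Clim_plus u v l m : Clim u l -> Clim v m -> Clim (fun n => u n + v n)%C (l + m)%C.
Proof.
  intros [H1 H2] [H3 H4]; split.
  - exact (is_lim_seq_plus' _ _ _ _ H1 H3).
  - exact (is_lim_seq_plus' _ _ _ _ H2 H4).
Qed.

Lemma Clim_scal (c : C) u l : Clim u l -> Clim (fun n => c * u n)%C (c * l)%C.
Proof.
  intros [H1 H2]; split.
  - apply (is_lim_seq_minus' (fun n => Re c * Re (u n)) (fun n => Im c * Im (u n))).
    + exact (is_lim_seq_scal_l _ (Re c) _ H1).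
    + exact (is_lim_seq_scal_l _ (Im c) _ H2).
  - apply (is_lim_seq_plus' (fun n => Re c * Im (u n)) (fun n => Im c * Re (u n))).
    + exact (is_lim_seq_scal_l _ (Re c) _ H2).
    + exact (is_lim_seq_scal_l _ (Im c) _ H1).
Qed.

Lemma Clim_ext u v l : (forall n, u n = v n) -> Clim u l -> Clim v l.
Proof.
  intros H [H1 H2]; split; [revert H1 | revert H2]; apply is_lim_seq_ext; intros n;
    rewrite H; reflexivity.
Qed.

Lemma Clim_succ u l : Clim u l <-> Clim (fun n => u (S n)) l.
Proof.
  split; intros [H1 H2]; (split; [apply (is_lim_seq_incr_1 (fun n => Re (u n))), H1
    | apply (is_lim_seq_incr_1 (fun n => Im (u n))), H2]).
Qed.

Lemma Clim_le_const u l (B : R) : Clim u l -> (forall n, Cmod (u n) <= B) -> Cmod l <= 2 * B.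
Proof.
  intros [H1 H2] HB.
  apply is_lim_seq_abs in H1. apply is_lim_seq_abs in H2.
  assert (K1 := is_lim_seq_le _ _ _ _ (fun n => Rle_trans _ _ _ (re_le_Cmod _) (HB n))
    H1 (is_lim_seq_const B)).
  assert (K2 := is_lim_seq_le _ _ _ _ (fun n => Rle_trans _ _ _ (im_le_Cmod _) (HB n))
    H2 (is_lim_seq_const B)).
  simpl in K1, K2. assert (X := Cmod_le_Re_Im l). lra.
Qed.

Lemma Clim_0_squeeze (u : nat -> C) (e : nat -> R) :
  (forall n, Cmod (u n) <= e n) -> is_lim_seq e 0 -> Clim u 0%C.
Proof.
  intros H He.
  assert (Hn : is_lim_seq (fun n => - e n) 0).
  { replace (Finite 0) with (Rbar_opp 0) by (simpl; f_equal; ring).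
    apply is_lim_seq_opp in He. exact He. }
  split; apply (is_lim_seq_le_le (fun n => - e n) _ e); auto; intros n;
    apply Rabs_le_between.
  - exact (Rle_trans _ _ _ (re_le_Cmod _) (H n)).
  - exact (Rle_trans _ _ _ (im_le_Cmod _) (H n)).
Qed.

(** Telescoping: 1/(n+1)^2 <= 1/n - 1/(n+1). *)
Lemma sum_inv_sq_bound (n : nat) : sum_f_R0 (fun i => / INR (S i) ^ 2) n <= 2 - / INR (S n).
Proof.
  induction n as [|n IH]; [simpl; lra|].
  change (sum_f_R0 (fun i => / INR (S i) ^ 2) (S n)) with
    (sum_f_R0 (fun i => / INR (S i) ^ 2) n + / INR (S (S n)) ^ 2).
  rewrite (S_INR (S n)). assert (X := lt_0_INR (S n) ltac:(lia)).
  set (y := INR (S n)) in *.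
  assert (E : / y - / (y + 1) - / (y + 1) ^ 2 = / (y * (y + 1) ^ 2)) by (field; lra).
  assert (0 < / (y * (y + 1) ^ 2)).
  { apply Rinv_0_lt_compat, Rmult_lt_0_compat; [lra | apply pow_lt; lra]. }
  lra.
Qed.

Lemma quadratic_steps_bounded (u : nat -> C) (K : R) : 0 <= K ->
  (forall n, Cmod (u (S n) - u n)%C <= K / INR (S n) ^ 2) ->
  forall n, Cmod (u n - u O)%C <= 2 * K.
Proof.
  intros HK H.
  assert (G : forall n, Cmod (u (S n) - u O)%C <= K * sum_f_R0 (fun i => / INR (S i) ^ 2) n).
  { induction n as [|n IH].
    - simpl sum_f_R0. apply H.
    - replace (u (S (S n)) - u O)%C with ((u (S n) - u O) + (u (S (S n)) - u (S n)))%C by ring.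
      eapply Rle_trans; [apply Cmod_triangle|].
      change (sum_f_R0 (fun i => / INR (S i) ^ 2) (S n)) with
        (sum_f_R0 (fun i => / INR (S i) ^ 2) n + / INR (S (S n)) ^ 2).
      specialize (H (S n)). unfold Rdiv in H. lra. }
  intros [|n].
  - replace (u O - u O)%C with (RtoC 0) by (rewrite <- (Cplus_opp_r (u O)); reflexivity). rewrite Cmod_0. lra.
  - eapply Rle_trans; [apply G|].
    assert (X := sum_inv_sq_bound n).
    assert (Y : 0 < / INR (S n)) by (apply Rinv_0_lt_compat, lt_0_INR; lia).
    rewrite (Rmult_comm 2). apply Rmult_le_compat_l; lra.
Qed.

Lemma ex_series_inv_sq : ex_series (fun n => / INR (S n) ^ 2).
Proof.
  apply ex_finite_lim_seq_incr with 2.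
  - intros n. rewrite (sum_Sn _ n). change plus with Rplus. simpl.
    assert (X : 0 < / INR (S (S n)) ^ 2) by (apply Rinv_0_lt_compat, pow_lt, lt_0_INR; lia).
    simpl in X. lra.
  - intros n. rewrite sum_n_Reals.
    assert (X := sum_inv_sq_bound n).
    assert (Y : 0 < / INR (S n)) by (apply Rinv_0_lt_compat, lt_0_INR; lia). lra.
Qed.

Lemma quadratic_steps_cv_R (u : nat -> R) (K : R) :
  (forall n, Rabs (u (S n) - u n) <= K / INR (S n) ^ 2) -> ex_finite_lim_seq u.
Proof.
  intros H.
  destruct (ex_series_le (fun n => u (S n) - u n) (fun n => K * / INR (S n) ^ 2)) as [l Hl].
  - exact H.
  - apply (@ex_series_scal R_AbsRing R_NormedModule K), ex_series_inv_sq.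
  - exists (l + u O). apply (is_lim_seq_incr_1 u).
    apply (is_lim_seq_ext (fun n => sum_n (fun n => u (S n) - u n) n + u O)).
    + induction n as [|n IH].
      * rewrite sum_O. ring.
      * rewrite sum_Sn. change plus with Rplus. simpl in IH |- *. lra.
    + apply (is_lim_seq_plus' _ _ l (u O)); [exact Hl | apply is_lim_seq_const].
Qed.

Lemma quadratic_steps_cv (u : nat -> C) (K : R) :
  (forall n, Cmod (u (S n) - u n)%C <= K / INR (S n) ^ 2) -> exists l, Clim u l.
Proof.
  intros H.
  destruct (quadratic_steps_cv_R (fun n => Re (u n)) K) as [x Hx].
  { intros n. eapply Rle_trans; [|apply (H n)]. apply (re_le_Cmod (u (S n) - u n)%C). }
  destruct (quadratic_steps_cv_R (fun n => Im (u n)) K) as [y Hy].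
  { intros n. eapply Rle_trans; [|apply (H n)]. apply (im_le_Cmod (u (S n) - u n)%C). }
  exists (x, y). split; assumption.
Qed.

(** * Iterated means *)

Fixpoint mean (k : nat) (u : nat -> C) (n : nat) : C :=
  match k with
  | O => u n
  | S k => / 2 * (mean k u n + mean k u (S n))
  end%C.

Fixpoint alt_sum (f : R -> C) (n : nat) : C :=
  match n with
  | O => 0
  | S n => alt_sum f n + RtoC ((-1) ^ n) * f (INR (S n))
  end%C.

Lemma alt_sum_S (f : R -> C) (n : nat) :
  alt_sum f (S n) = (alt_sum f n + RtoC ((-1) ^ n) * f (INR (S n)))%C.
Proof. reflexivity. Qed.

(** Averaging two consecutive partial sums of an alternating series replaces
    its terms by half their successive differences. *)
Lemma mean_alt_sum_step (f : R -> C) (k n : nat) :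
  (mean k (alt_sum f) (S n) - mean k (alt_sum f) n)%C
  = (RtoC ((-1) ^ n) * (RtoC ((/ 2) ^ k) * diff k f (INR (S n))))%C.
Proof.
  revert n; induction k as [|k IH]; intros n.
  - simpl. ring.
  - change (mean (S k) (alt_sum f) (S n)) with
      (/ 2 * (mean k (alt_sum f) (S n) + mean k (alt_sum f) (S (S n))))%C.
    change (mean (S k) (alt_sum f) n) with
      (/ 2 * (mean k (alt_sum f) n + mean k (alt_sum f) (S n)))%C.
    transitivity (/ 2 * ((mean k (alt_sum f) (S n) - mean k (alt_sum f) n)
      + (mean k (alt_sum f) (S (S n)) - mean k (alt_sum f) (S n))))%C; [ring|].
    rewrite !IH. rewrite (S_INR (S n)).
    change (diff (S k) f (INR (S n))) with (diff k f (INR (S n)) - diff k f (INR (S n) + 1))%C.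
    replace ((/ 2) ^ S k) with (/ 2 * (/ 2) ^ k) by reflexivity.
    replace ((-1) ^ S n) with (- (-1) ^ n) by (simpl; ring).
    rewrite RtoC_mult, RtoC_opp, RtoC_inv by lra. ring.
Qed.

Lemma Clim_mean (k : nat) u l : Clim u l -> Clim (mean k u) l.
Proof.
  intros H; induction k as [|k IH]; [exact H|].
  replace l with (/ 2 * (l + l))%C by field.
  apply Clim_scal, Clim_plus; [exact IH | apply -> Clim_succ; exact IH].
Qed.

Lemma mean_ext (k : nat) u v : (forall n, u n = v n) -> forall n, mean k u n = mean k v n.
Proof. intros H; induction k as [|k IH]; intros n; simpl; [apply H | rewrite !IH; reflexivity]. Qed.

Lemma mean_add (j k : nat) u n : mean (j + k) u n = mean j (mean k u) n.
Proof. revert n; induction j as [|j IH]; intros n; simpl; [reflexivity | rewrite !IH; reflexivity]. Qed.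

Lemma mean_plus (k : nat) u v n :
  mean k (fun n => u n + v n)%C n = (mean k u n + mean k v n)%C.
Proof. revert n; induction k as [|k IH]; intros n; simpl; [reflexivity | rewrite !IH; ring]. Qed.

Lemma mean_scal (k : nat) c u n : mean k (fun n => c * u n)%C n = (c * mean k u n)%C.
Proof. revert n; induction k as [|k IH]; intros n; simpl; [reflexivity | rewrite !IH; ring]. Qed.

Lemma mean_succ (k : nat) u n : mean k (fun n => u (S n)) n = mean k u (S n).
Proof. revert n; induction k as [|k IH]; intros n; simpl; [reflexivity | rewrite !IH; ring]. Qed.

(** Summation by averaging a sufficient number of times. *)
Definition Euler_sum (u : nat -> C) (l : C) : Prop := exists k, Clim (mean k u) l.

(** Two numbers of averages j and k compare through j + k, as averaging
    preserves limits. *)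
Lemma Euler_sum_unique u l m : Euler_sum u l -> Euler_sum u m -> l = m.
Proof.
  intros [j Hj] [k Hk].
  apply (Clim_unique (mean (k + j) u)).
  - apply (Clim_ext (mean k (mean j u))); [intros n; symmetry; apply mean_add | apply Clim_mean, Hj].
  - rewrite Nat.add_comm.
    apply (Clim_ext (mean j (mean k u))); [intros n; symmetry; apply mean_add | apply Clim_mean, Hk].
Qed.

Lemma Euler_sum_plus u v l m :
  Euler_sum u l -> Euler_sum v m -> Euler_sum (fun n => u n + v n)%C (l + m)%C.
Proof.
  intros [j Hj] [k Hk]. exists (k + j)%nat.
  apply (Clim_ext (fun n => mean (k + j) u n + mean (k + j) v n)%C).
  { intros n; symmetry; apply mean_plus. }
  apply Clim_plus.
  - apply (Clim_ext (mean k (mean j u))); [intros n; symmetry; apply mean_add | apply Clim_mean, Hj].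
  - rewrite Nat.add_comm.
    apply (Clim_ext (mean j (mean k v))); [intros n; symmetry; apply mean_add | apply Clim_mean, Hk].
Qed.

Lemma Euler_sum_Clim u l : Clim u l -> Euler_sum u l.
Proof. intros H; exists O; exact H. Qed.

(** If the steps tend to 0, so do those of every iterated mean, and
    one averaging moves a sequence by half a step: averages can be removed
    one at a time. *)
Lemma Euler_sum_Tauber u l :
  Clim (fun n => u (S n) - u n)%C 0%C -> Euler_sum u l -> Clim u l.
Proof.
  intros H0 [k Hk]. induction k as [|k IH]; [exact Hk|].
  apply IH. clear IH.
  assert (D : Clim (fun n => mean k u (S n) - mean k u n)%C 0%C).
  { apply (Clim_ext (mean k (fun n => u (S n) - u n)%C)); [|apply Clim_mean, H0].
    intros n. rewrite <- mean_succ.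
    transitivity (mean k (fun n => u (S n) + (-(1)) * u n)%C n).
    - apply mean_ext. intros m; ring.
    - rewrite mean_plus, mean_scal. ring. }
  replace l with (l + (- / 2) * 0)%C by ring.
  eapply Clim_ext; [|apply Clim_plus; [exact Hk | apply (Clim_scal (- / 2)%C), D]].
  intros n. simpl. field.
Qed.

(** * The continuation of the alternating zeta function *)

(** With coefficients (1, 0, 0), (0, -1, 0) and (0, 0, 1) these are the partial
    sums of the series for zeta_E and of its first two derivatives in s. *)
Definition eta_sums (c0 c1 c2 s : C) : nat -> C := alt_sum (log_power c0 c1 c2 s).

Lemma Cmod_sign (n : nat) : Cmod (RtoC ((-1) ^ n)) = 1.
Proof. rewrite Cmod_R. apply pow_1_abs. Qed.

(** The condition on k depends on s only through the bound r of its modulus: this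
    gives the local uniformity needed to differentiate the limit. *)
Lemma mean_eta_step (c0 c1 c2 s : C) (k : nat) (r : R) (n : nat) :
  Cmod c0 <= 1 -> Cmod c1 <= 1 -> Cmod c2 <= 1 -> Cmod s <= r -> 4 + r <= INR k ->
  Cmod (mean k (eta_sums c0 c1 c2 s) (S n) - mean k (eta_sums c0 c1 c2 s) n)%C
    <= diff_const k r / INR (S n) ^ 2.
Proof.
  intros H0 H1 H2 Hs Hk. unfold eta_sums.
  rewrite mean_alt_sum_step, !Cmod_mult, Cmod_sign, Cmod_R, Rmult_1_l.
  assert (Hn : 1 <= INR (S n)) by (rewrite S_INR; assert (X := pos_INR n); lra).
  assert (B : Cmod (diff k (log_power c0 c1 c2 s) (INR (S n))) <= diff_const k r * 1 / INR (S n) ^ 2).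
  { apply diff_log_power_bound; auto. assert (X := re_le_Cmod s). apply Rabs_le_between in X. lra. }
  rewrite Rmult_1_r in B.
  eapply Rle_trans; [|exact B].
  rewrite <- (Rmult_1_l (Cmod (diff _ _ _))) at 2.
  apply Rmult_le_compat_r; [apply Cmod_ge_0|].
  rewrite Rabs_pos_eq by (apply pow_le; lra).
  rewrite <- (pow1 k). apply pow_incr; lra.
Qed.

Lemma mean_eta_cv (c0 c1 c2 s : C) (k : nat) (r : R) :
  Cmod c0 <= 1 -> Cmod c1 <= 1 -> Cmod c2 <= 1 -> Cmod s <= r -> 4 + r <= INR k ->
  exists l, Clim (mean k (eta_sums c0 c1 c2 s)) l.
Proof.
  intros H0 H1 H2 Hs Hk.
  apply (quadratic_steps_cv _ (diff_const k r)). intros n. apply mean_eta_step; assumption.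
Qed.

Lemma exists_INR_ge (r : R) : exists k, r <= INR k.
Proof.
  exists (Z.to_nat (up r)). rewrite INR_IZR_INZ.
  destruct (archimed r) as [X _].
  assert (Y : (up r <= Z.of_nat (Z.to_nat (up r)))%Z) by lia.
  apply IZR_le in Y. lra.
Qed.

Lemma eta_Euler_summable (c0 c1 c2 s : C) :
  Cmod c0 <= 1 -> Cmod c1 <= 1 -> Cmod c2 <= 1 ->
  exists l, Euler_sum (eta_sums c0 c1 c2 s) l.
Proof.
  intros H0 H1 H2. destruct (exists_INR_ge (4 + Cmod s)) as [k Hk].
  destruct (mean_eta_cv c0 c1 c2 s k (Cmod s)) as [l Hl]; auto; [lra|].
  exists l, k. exact Hl.
Qed.

Lemma mean_eta_Clim (c0 c1 c2 s l : C) (k : nat) (r : R) :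
  Cmod c0 <= 1 -> Cmod c1 <= 1 -> Cmod c2 <= 1 -> Cmod s <= r -> 4 + r <= INR k ->
  Euler_sum (eta_sums c0 c1 c2 s) l -> Clim (mean k (eta_sums c0 c1 c2 s)) l.
Proof.
  intros H0 H1 H2 Hs Hk Hl.
  destruct (mean_eta_cv c0 c1 c2 s k r) as [m Hm]; auto.
  rewrite (Euler_sum_unique _ l m Hl); [exact Hm | exists k; exact Hm].
Qed.

Lemma eta_sums_bounded (c0 c1 c2 : C) (r : R) (n : nat) :
  exists B, forall s, Cmod s <= r -> Cmod (eta_sums c0 c1 c2 s n) <= B.
Proof.
  induction n as [|n [B IH]].
  - exists 0. intros s _. change (Cmod 0 <= 0). rewrite Cmod_0. lra.
  - set (L := ln (INR (S n))).
    exists (B + Cmod (c0 + c1 * RtoC L + c2 * (RtoC L * RtoC L))%C * exp (r * Rabs L)).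
    intros s Hs. unfold eta_sums in *. rewrite alt_sum_S.
    eapply Rle_trans; [apply Cmod_triangle|]. apply Rplus_le_compat; [apply IH, Hs|].
    rewrite Cmod_mult, Cmod_sign, Rmult_1_l. unfold log_power. rewrite Cmod_mult.
    apply Rmult_le_compat_l; [apply Cmod_ge_0|].
    unfold Rpow_neg. rewrite Cmod_Cexp. fold L.
    assert (X : Re (- s * RtoC L) <= r * Rabs L).
    { eapply Rle_trans; [apply Rle_abs|]. eapply Rle_trans; [apply re_le_Cmod|].
      rewrite Cmod_mult, Cmod_opp, Cmod_R. apply Rmult_le_compat_r; [apply Rabs_pos | exact Hs]. }
    destruct X as [X | ->]; [left; apply exp_increasing, X | right; reflexivity].
Qed.

Lemma mean_eta_bounded_at (c0 c1 c2 : C) (r : R) (k n : nat) :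
  exists B, forall s, Cmod s <= r -> Cmod (mean k (eta_sums c0 c1 c2 s) n) <= B.
Proof.
  revert n; induction k as [|k IH]; intros n; [apply eta_sums_bounded|].
  destruct (IH n) as [B1 H1]. destruct (IH (S n)) as [B2 H2].
  exists (/ 2 * (B1 + B2)). intros s Hs. simpl mean.
  rewrite Cmod_mult, Cmod_inv, Cmod_R, Rabs_pos_eq by (lra || (intros X; injection X; lra)).
  apply Rmult_le_compat_l; [lra|].
  eapply Rle_trans; [apply Cmod_triangle|]. apply Rplus_le_compat; [apply H1 | apply H2]; exact Hs.
Qed.

Lemma mean_eta_bounded (c0 c1 c2 : C) (r : R) (k : nat) :
  0 <= r -> Cmod c0 <= 1 -> Cmod c1 <= 1 -> Cmod c2 <= 1 -> 4 + r <= INR k ->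
  exists B, forall s n, Cmod s <= r -> Cmod (mean k (eta_sums c0 c1 c2 s) n) <= B.
Proof.
  intros Hr H0 H1 H2 Hk.
  destruct (mean_eta_bounded_at c0 c1 c2 r k 0) as [B HB].
  exists (B + 2 * diff_const k r). intros s n Hs.
  set (u := mean k (eta_sums c0 c1 c2 s)) in *.
  replace (u n) with (u O + (u n - u O))%C by (fold (u n - u O)%C; ring).
  eapply Rle_trans; [apply Cmod_triangle|]. apply Rplus_le_compat; [apply HB, Hs|].
  apply quadratic_steps_bounded.
  - left. apply diff_const_pos, Hr.
  - intros m. apply mean_eta_step; assumption.
Qed.

Lemma is_Rderive_eta_sums (c0 c1 c2 d0 d1 d2 s w : C) (n : nat) (t : R) :
  (forall q x, - RtoC (ln x) * log_power c0 c1 c2 q x = log_power d0 d1 d2 q x)%C ->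
  is_Rderive (fun t => eta_sums c0 c1 c2 (s + RtoC t * w)%C n) t
    (w * eta_sums d0 d1 d2 (s + RtoC t * w) n)%C.
Proof.
  intros H. unfold eta_sums. induction n as [|n IH].
  - change (is_Rderive (fun _ => RtoC 0) t (w * RtoC 0)%C).
    rewrite Cmult_0_r. apply is_Rderive_const.
  - eapply is_Rderive_eq.
    + apply is_Rderive_plus; [exact IH|].
      apply is_Rderive_scal, is_Rderive_log_power_exponent.
    + rewrite H, alt_sum_S. ring.
Qed.

(** Differentiation in s multiplies the terms by - ln x; the hypothesis says that
    this turns the coefficients c into d. *)
Lemma is_Rderive_mean_eta (c0 c1 c2 d0 d1 d2 s w : C) (k n : nat) (t : R) :
  (forall q x, - RtoC (ln x) * log_power c0 c1 c2 q x = log_power d0 d1 d2 q x)%C ->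
  is_Rderive (fun t => mean k (eta_sums c0 c1 c2 (s + RtoC t * w)%C) n) t
    (w * mean k (eta_sums d0 d1 d2 (s + RtoC t * w)%C) n)%C.
Proof.
  intros H. revert n; induction k as [|k IH]; intros n; simpl mean.
  - apply is_Rderive_eta_sums, H.
  - eapply is_Rderive_eq.
    + apply is_Rderive_scal, is_Rderive_plus; apply IH.
    + ring.
Qed.

(** The averaged sums satisfy |T(s + w) - T(s) - w T1(s)| <= 4 B |w|^2 with B
    independent of their index, and this inequality survives in the limit. *)
Lemma Euler_sum_is_derive (f f' : C -> C) :
  (forall s, Euler_sum (eta_sums 1 0 0 s) (f s)) ->
  (forall s, Euler_sum (eta_sums 0 (-(1)) 0 s) (f' s)) ->
  forall s, @is_derive C_AbsRing C_NormedModule f s (f' s).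
Proof.
  intros Hf Hf' s.
  assert (M0 : Cmod 0 <= 1) by (rewrite Cmod_0; lra).
  assert (M1 : Cmod 1 <= 1) by (rewrite Cmod_1; lra).
  assert (M2 : Cmod (-(1))%C <= 1) by (rewrite Cmod_m1; lra).
  set (r := Cmod s + 1).
  assert (Hr : 0 <= r) by (assert (X := Cmod_ge_0 s); unfold r; lra).
  destruct (exists_INR_ge (4 + r)) as [k Hk].
  (* The number k of averages is chosen for the whole disc of radius r around 0, which
     contains the unit disc around s. *)
  destruct (mean_eta_bounded 0 0 1 r k) as [B HB]; auto.
  apply (C_is_derive_quadratic f s (f' s) 1 (2 * (4 * B))); [lra|].
  intros w Hw.
  assert (Hline : forall t, 0 <= t <= 1 -> Cmod (s + RtoC t * w)%C <= r).
  { intros t Ht. eapply Rle_trans; [apply Cmod_triangle|].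
    rewrite Cmod_mult, Cmod_R, Rabs_pos_eq by lra.
    assert (X := Cmod_ge_0 w). unfold r. nra. }
  assert (Hs : Cmod s <= r) by (unfold r; lra).
  assert (Hsw : Cmod (s + w)%C <= r).
  { replace (s + w)%C with (s + RtoC 1 * w)%C by ring. apply Hline; lra. }
  assert (L : Clim (fun n => mean k (eta_sums 1 0 0 (s + w)%C) n
      + ((-(1)) * mean k (eta_sums 1 0 0 s) n + (- w) * mean k (eta_sums 0 (-(1)) 0 s) n))%C
      (f (s + w) + ((-(1)) * f s + (- w) * f' s))%C).
  { apply Clim_plus; [|apply Clim_plus; apply Clim_scal]; eapply mean_eta_Clim; eauto. }
  replace (f (s + w) - f s - w * f' s)%C with (f (s + w) + ((-(1)) * f s + (- w) * f' s))%C by ring.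
  replace (2 * (4 * B) * Cmod w ^ 2) with (2 * (4 * B * Cmod w ^ 2)) by ring.
  apply (Clim_le_const _ _ _ L). intros n.
  replace (_ + _)%C with (mean k (eta_sums 1 0 0 (s + w)%C) n
    - mean k (eta_sums 1 0 0 s) n - w * mean k (eta_sums 0 (-(1)) 0 s) n)%C by ring.
  apply (Taylor_bound (fun s => mean k (eta_sums 1 0 0 s) n)
    (fun s => mean k (eta_sums 0 (-(1)) 0 s) n) (fun s => mean k (eta_sums 0 0 1 s) n)).
  - intros t. apply is_Rderive_mean_eta. intros q x. unfold log_power. ring.
  - intros t. apply is_Rderive_mean_eta. intros q x. unfold log_power. ring.
  - intros t Ht. apply HB, Hline, Ht.
Qed.

Lemma eta_sums_series (s : C) (n : nat) :
  @sum_n C_AbelianMonoid (zetaE_term s) n = eta_sums 1 0 0 s (S n).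
Proof.
  assert (E : forall n, zetaE_term s n = (RtoC ((-1) ^ n) * log_power 1 0 0 s (INR (S n)))%C).
  { intros m. unfold zetaE_term, nat_Cpower, log_power, Rpow_neg. ring. }
  induction n as [|n IH].
  - rewrite sum_O, E. unfold eta_sums. rewrite alt_sum_S. change (alt_sum (log_power 1 0 0 s) 0) with (RtoC 0).
    rewrite Cplus_0_l. reflexivity.
  - rewrite sum_Sn, IH, E. reflexivity.
Qed.

Lemma eta_sums_steps_to_0 (s : C) : 0 < Re s ->
  Clim (fun n => eta_sums 1 0 0 s (S n) - eta_sums 1 0 0 s n)%C 0%C.
Proof.
  intros Hs.
  apply (Clim_0_squeeze _ (fun n => exp (- Re s * ln (INR (S n))))).
  - intros n. right. unfold eta_sums. rewrite alt_sum_S.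
    replace (_ - _)%C with (RtoC ((-1) ^ n) * Rpow_neg s (INR (S n)))%C
      by (unfold log_power; ring).
    rewrite Cmod_mult, Cmod_sign, Rmult_1_l. unfold Rpow_neg. rewrite Cmod_Cexp.
    f_equal. simpl Re. unfold Re. simpl. ring.
  - apply (is_lim_seq_incr_1 (fun n => exp (- Re s * ln (INR n)))).
    apply (is_lim_comp_seq exp _ m_infty 0 is_lim_exp_m).
    + exists O. intros; discriminate.
    + replace m_infty with (Rbar_mult (- Re s) p_infty).
      * apply is_lim_seq_scal_l.
        apply (is_lim_comp_seq ln _ p_infty p_infty is_lim_ln_p).
        -- exists O. intros; discriminate.
        -- apply is_lim_seq_INR.
      * apply is_Rbar_mult_unique, is_Rbar_mult_sym, is_Rbar_mult_p_infty_neg. simpl; lra.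
Qed.

(** For Re s > 0 the terms of the series tend to 0, so that it converges to its
    averaged sum. *)
Lemma Euler_sum_is_zetaE (f f' : C -> C) :
  (forall s, Euler_sum (eta_sums 1 0 0 s) (f s)) ->
  (forall s, Euler_sum (eta_sums 0 (-(1)) 0 s) (f' s)) -> is_zetaE f.
Proof.
  intros Hf Hf'. split.
  - intros s. exists (f' s). apply (Euler_sum_is_derive f f' Hf Hf').
  - intros s Hs.
    assert (L : Clim (eta_sums 1 0 0 s) (f s)).
    { apply Euler_sum_Tauber; [apply eta_sums_steps_to_0, Hs | apply Hf]. }
    apply Clim_succ in L.
    assert (L' : Clim (fun n => @sum_n C_AbelianMonoid (zetaE_term s) n) (f s)).
    { apply (Clim_ext _ _ _ (fun n => eq_sym (eta_sums_series s n)) L). }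
    destruct L' as [L1 L2]. exact (C_filterlim_components _ _ L1 L2).
Qed.

Lemma exists_continuation : exists f f' : C -> C,
  (forall s, Euler_sum (eta_sums 1 0 0 s) (f s)) /\
  (forall s, Euler_sum (eta_sums 0 (-(1)) 0 s) (f' s)).
Proof.
  assert (M0 : Cmod 0 <= 1) by (rewrite Cmod_0; lra).
  assert (M1 : Cmod 1 <= 1) by (rewrite Cmod_1; lra).
  assert (M2 : Cmod (-(1))%C <= 1) by (rewrite Cmod_m1; lra).
  exists (fun s => proj1_sig (constructive_indefinite_description _
    (eta_Euler_summable 1 0 0 s M1 M0 M0))).
  exists (fun s => proj1_sig (constructive_indefinite_description _
    (eta_Euler_summable 0 (-(1)) 0 s M0 M2 M0))).
  split; intros s; apply proj2_sig.
Qed.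

(** * The Glaisher-Kinkelin limit *)

Lemma nonneg_of_derive_nonneg (f f' : R -> R) (x : R) : 0 < x -> f 0 = 0 ->
  (forall t, 0 <= t -> is_derive f t (f' t)) -> (forall t, 0 <= t -> 0 <= f' t) -> 0 <= f x.
Proof.
  intros Hx H0 Hd Hp.
  destruct (MVT_cor2 f f' 0 x Hx) as [c [E Hc]].
  - intros c Hc. apply is_derive_Reals, Hd; lra.
  - specialize (Hp c ltac:(lra)). nra.
Qed.

Lemma ln_1p_upper (u : R) : 0 < u -> ln (1 + u) <= u - u ^ 2 / 2 + u ^ 3 / 3.
Proof.
  intros Hu. apply Rminus_le_0.
  apply (nonneg_of_derive_nonneg (fun u => u - u ^ 2 / 2 + u ^ 3 / 3 - ln (1 + u))
    (fun u => u ^ 3 / (1 + u))); auto.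
  - rewrite Rplus_0_r, ln_1. field.
  - intros t Ht. auto_derive; [lra|]. field. lra.
  - intros t Ht. apply Rdiv_le_0_compat; [apply pow_le; lra | lra].
Qed.

Lemma ln_1p_lower (u : R) : 0 < u -> u - u ^ 2 / 2 + u ^ 3 / 3 - u ^ 4 / 4 <= ln (1 + u).
Proof.
  intros Hu. apply Rminus_le_0.
  apply (nonneg_of_derive_nonneg (fun u => ln (1 + u) - (u - u ^ 2 / 2 + u ^ 3 / 3 - u ^ 4 / 4))
    (fun u => u ^ 4 / (1 + u))); auto.
  - rewrite Rplus_0_r, ln_1. field.
  - intros t Ht. auto_derive; [lra|]. field. lra.
  - intros t Ht. apply Rdiv_le_0_compat; [apply pow_le; lra | lra].
Qed.

Definition ln_hyperfactorial (n : nat) : R := ln (hyperfactorial n).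

Lemma hyperfactorial_pos (n : nat) : 0 < hyperfactorial n.
Proof.
  induction n as [|n IH]; unfold hyperfactorial in *.
  - simpl. lra.
  - change (0 < prod_f_R0 (fun k => INR k ^ k) n * INR (S n) ^ S n).
    apply Rmult_lt_0_compat; [exact IH | apply pow_lt, lt_0_INR; lia].
Qed.

Lemma ln_hyperfactorial_0 : ln_hyperfactorial 0 = 0.
Proof. exact ln_1. Qed.

Lemma ln_hyperfactorial_S (n : nat) :
  ln_hyperfactorial (S n) = ln_hyperfactorial n + INR (S n) * ln (INR (S n)).
Proof.
  assert (X : 0 < INR (S n)) by (apply lt_0_INR; lia).
  unfold ln_hyperfactorial.
  change (hyperfactorial (S n)) with (hyperfactorial n * INR (S n) ^ S n).
  rewrite ln_mult, ln_pow; auto using hyperfactorial_pos, pow_lt.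
Qed.

Definition ln_glaisher_seq (n : nat) : R :=
  ln_hyperfactorial n - (INR n ^ 2 / 2 + INR n / 2 + 1 / 12) * ln (INR n) + INR n ^ 2 / 4.

Lemma glaisher_seq_exp (n : nat) : glaisher_seq n = exp (ln_glaisher_seq n).
Proof.
  unfold glaisher_seq, ln_glaisher_seq, ln_hyperfactorial, Rpower, Rminus, Rdiv.
  rewrite !exp_plus, exp_ln, exp_Ropp by apply hyperfactorial_pos. reflexivity.
Qed.

(** With p(n) = n^2/2 + n/2 + 1/12 one has p(n + 1) - (n + 1) = p(n), so the step
    is - p(n) ln(1 + 1/n) + (2n + 1)/4.  The constant 1/12 is the one for which
    the term of order 1/n cancels as well. *)
Lemma ln_glaisher_step (n : nat) :
  Rabs (ln_glaisher_seq (S (S n)) - ln_glaisher_seq (S n)) <= 1 / INR (S n) ^ 2.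
Proof.
  unfold ln_glaisher_seq. rewrite ln_hyperfactorial_S, (S_INR (S n)).
  assert (X : 1 <= INR (S n)) by (rewrite S_INR; assert (X := pos_INR n); lra).
  set (x := INR (S n)) in *.
  assert (E : ln (x + 1) = ln x + ln (1 + / x)).
  { rewrite <- ln_mult; [f_equal; field; lra | lra |].
    assert (0 < / x) by (apply Rinv_0_lt_compat; lra). lra. }
  rewrite E. clear E.
  assert (Hu : 0 < / x) by (apply Rinv_0_lt_compat; lra).
  assert (Hu1 : / x <= 1) by (rewrite <- Rinv_1; apply Rinv_le_contravar; lra).
  assert (U := ln_1p_upper _ Hu). assert (L := ln_1p_lower _ Hu).
  set (l := ln (1 + / x)) in *.
  replace (_ - _) with (- ((x ^ 2 / 2 + x / 2 + 1 / 12) * l) + (2 * x + 1) / 4) by field.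
  set (p := x ^ 2 / 2 + x / 2 + 1 / 12).
  assert (Hp : 0 < p) by (unfold p; nra).
  apply (Rmult_le_compat_l p) in U; [|lra]. apply (Rmult_le_compat_l p) in L; [|lra].
  replace (p * (/ x - (/ x) ^ 2 / 2 + (/ x) ^ 3 / 3)) with
    ((2 * x + 1) / 4 + ((/ x) ^ 2 / 8 + (/ x) ^ 3 / 36)) in U by (unfold p; field; lra).
  replace (p * (/ x - (/ x) ^ 2 / 2 + (/ x) ^ 3 / 3 - (/ x) ^ 4 / 4)) with
    ((2 * x + 1) / 4 - (7 / 72 * (/ x) ^ 3 + (/ x) ^ 4 / 48)) in L by (unfold p; field; lra).
  replace (1 / x ^ 2) with ((/ x) ^ 2) by (field; lra).
  set (u := / x) in *.
  assert (0 <= u ^ 3 <= u ^ 2) by (split; nra).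
  assert (0 <= u ^ 4 <= u ^ 2) by (split; nra).
  apply Rabs_le. split; lra.
Qed.

Lemma glaisher_limit : exists l : R,
  is_lim_seq (fun n => ln_glaisher_seq n) l /\ glaisher = exp l.
Proof.
  destruct (quadratic_steps_cv_R (fun n => ln_glaisher_seq (S n)) 1 ln_glaisher_step) as [l Hl].
  apply (is_lim_seq_incr_1 ln_glaisher_seq) in Hl.
  exists l. split; [exact Hl|].
  unfold glaisher. rewrite (is_lim_seq_unique _ (exp l)); [reflexivity|].
  apply (is_lim_seq_ext (fun n => exp (ln_glaisher_seq n))).
  - intros n. symmetry. apply glaisher_seq_exp.
  - apply (is_lim_seq_continuous exp _ l); [|exact Hl].
    apply derivable_continuous_pt, derivable_pt_exp.
Qed.

(** The sum of (-1)^m m ln m, that is, the logarithm of the n-th partial product of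
    the regularized product; the signs are written as in [alt_sum]. *)
Fixpoint alt_xlnx (n : nat) : R :=
  match n with
  | O => 0
  | S n => alt_xlnx n - (-1) ^ n * (INR (S n) * ln (INR (S n)))
  end.

Lemma eta_sums_at_m1 (n : nat) : eta_sums 0 (-(1)) 0 (RtoC (-1)) n = RtoC (alt_xlnx n).
Proof.
  induction n as [|n IH]; [reflexivity|].
  unfold eta_sums in *. rewrite alt_sum_S, IH.
  assert (X : 0 < INR (S n)) by (apply lt_0_INR; lia).
  change (alt_xlnx (S n)) with (alt_xlnx n - (-1) ^ n * (INR (S n) * ln (INR (S n)))).
  unfold log_power, Rpow_neg.
  replace (- RtoC (-1) * RtoC (ln (INR (S n))))%C with (RtoC (ln (INR (S n))))
    by ring.
  rewrite Cexp_RtoC, exp_ln by assumption.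
  rewrite RtoC_minus, !RtoC_mult. ring.
Qed.

(** The even terms, counted twice, minus all the terms; the even ones
    are 2j ln(2j) = 2j ln 2 + 2j ln j. *)
Lemma alt_xlnx_even (n : nat) :
  alt_xlnx (2 * n) = 4 * ln_hyperfactorial n + 2 * ln 2 * (INR n * (INR n + 1))
    - ln_hyperfactorial (2 * n).
Proof.
  induction n as [|n IH].
  - simpl. rewrite ln_hyperfactorial_0. ring.
  - replace (2 * S n)%nat with (S (S (2 * n))) by lia.
    rewrite !ln_hyperfactorial_S.
    change (alt_xlnx (S (S (2 * n)))) with (alt_xlnx (2 * n)
      - (-1) ^ (2 * n) * (INR (S (2 * n)) * ln (INR (S (2 * n))))
      - (-1) ^ (S (2 * n)) * (INR (S (S (2 * n))) * ln (INR (S (S (2 * n)))))).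
    rewrite IH, pow_1_even, pow_1_odd.
    replace (INR (S (S (2 * n)))) with (2 * INR (S n)) by (rewrite !S_INR, mult_INR; simpl; ring).
    rewrite (ln_mult 2 (INR (S n))) by (lra || (apply lt_0_INR; lia)).
    rewrite (S_INR n). ring.
Qed.

(** The amplitude of the oscillating part of [alt_xlnx]; the constant 1/4 is the
    one that gives the even and odd partial sums the same limit. *)
Definition boundary (x : R) : R := / 2 * (x * ln x) + (/ 4 + / 4 * ln x).

Lemma alt_xlnx_even_boundary (n : nat) : (1 <= n)%nat ->
  alt_xlnx (2 * n) - boundary (INR (2 * n))
  = 4 * ln_glaisher_seq n - ln_glaisher_seq (2 * n) - ln 2 / 3 - 1 / 4.
Proof.
  intros Hn. rewrite alt_xlnx_even. unfold boundary, ln_glaisher_seq.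
  rewrite mult_INR. replace (INR 2) with 2 by reflexivity.
  rewrite (ln_mult 2 (INR n)) by (lra || (apply lt_0_INR; lia)). field.
Qed.

(** With x = 2n the difference is 1/2 - (x/2 + 1/4) ln(1 + 1/x). *)
Lemma alt_xlnx_odd_boundary (n : nat) : (1 <= n)%nat ->
  Rabs ((alt_xlnx (S (2 * n)) + boundary (INR (S (2 * n))))
    - (alt_xlnx (2 * n) - boundary (INR (2 * n)))) <= / INR n.
Proof.
  intros Hn.
  change (alt_xlnx (S (2 * n))) with (alt_xlnx (2 * n)
      - (-1) ^ (2 * n) * (INR (S (2 * n)) * ln (INR (S (2 * n))))).
  rewrite pow_1_even, (S_INR (2 * n)).
  assert (X : 1 <= INR n) by (apply (le_INR 1), Hn).
  rewrite mult_INR. replace (INR 2) with 2 by reflexivity.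
  unfold boundary. set (x := 2 * INR n).
  assert (Hx : 2 <= x) by (unfold x; lra).
  assert (Hu : 0 < / x) by (apply Rinv_0_lt_compat; lra).
  replace (/ INR n) with (2 * / x) by (unfold x; field; lra).
  clearbody x. clear X.
  assert (E : ln (x + 1) = ln x + ln (1 + / x)).
  { rewrite <- ln_mult by lra. f_equal; field; lra. }
  rewrite E. clear E.
  assert (Hu1 : / x <= 1) by (rewrite <- Rinv_1; apply Rinv_le_contravar; lra).
  assert (U := ln_1p_upper _ Hu). assert (L := ln_1p_lower _ Hu).
  set (l := ln (1 + / x)) in *.
  replace (_ - _) with (- ((x / 2 + / 4) * l) + / 2) by field.
  apply (Rmult_le_compat_l (x / 2 + / 4)) in U; [|lra].
  apply (Rmult_le_compat_l (x / 2 + / 4)) in L; [|lra].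
  replace ((x / 2 + / 4) * (/ x - (/ x) ^ 2 / 2 + (/ x) ^ 3 / 3)) with
    (/ 2 + ((/ x) ^ 2 / 24 + (/ x) ^ 3 / 12)) in U by (field; lra).
  replace ((x / 2 + / 4) * (/ x - (/ x) ^ 2 / 2 + (/ x) ^ 3 / 3 - (/ x) ^ 4 / 4)) with
    (/ 2 + (/ x) ^ 2 / 24 - (/ x) ^ 3 / 24 - (/ x) ^ 4 / 16) in L by (field; lra).
  set (u := / x) in *.
  assert (0 <= u ^ 2 <= u) by (split; nra).
  assert (0 <= u ^ 3 <= u) by (split; nra).
  assert (0 <= u ^ 4 <= u) by (split; nra).
  apply Rabs_le. split; lra.
Qed.

Lemma is_lim_seq_even_odd (u : nat -> R) (l : R) :
  is_lim_seq (fun n => u (2 * n)%nat) l -> is_lim_seq (fun n => u (S (2 * n))) l -> is_lim_seq u l.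
Proof.
  intros H1 H2. apply is_lim_seq_spec in H1. apply is_lim_seq_spec in H2.
  apply is_lim_seq_spec. intros eps.
  destruct (H1 eps) as [N1 K1], (H2 eps) as [N2 K2].
  exists (2 * (N1 + N2) + 1)%nat. intros n Hn.
  destruct (Nat.Even_or_Odd n) as [[m ->] | [m ->]].
  - apply K1. lia.
  - rewrite Nat.add_1_r. apply K2. lia.
Qed.

Lemma alt_xlnx_limit (l : R) : is_lim_seq ln_glaisher_seq l ->
  is_lim_seq (fun n => alt_xlnx n - (-1) ^ n * boundary (INR n)) (3 * l - ln 2 / 3 - 1 / 4).
Proof.
  intros Hl.
  assert (He : is_lim_seq (fun n => alt_xlnx (2 * n) - boundary (INR (2 * n)))
    (3 * l - ln 2 / 3 - 1 / 4)).
  { apply (is_lim_seq_ext_loc (fun n => 4 * ln_glaisher_seq n - ln_glaisher_seq (2 * n)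
      - ln 2 / 3 - 1 / 4)).
    { exists 1%nat. intros n Hn. symmetry. apply alt_xlnx_even_boundary, Hn. }
    replace (3 * l - ln 2 / 3 - 1 / 4) with (4 * l - l - ln 2 / 3 - 1 / 4) by ring.
    apply is_lim_seq_minus'; [|apply is_lim_seq_const].
    apply is_lim_seq_minus'; [|apply is_lim_seq_const].
    apply is_lim_seq_minus'.
    - exact (is_lim_seq_scal_l _ 4 _ Hl).
    - apply (is_lim_seq_subseq ln_glaisher_seq l (fun n => (2 * n)%nat)); [|exact Hl].
      apply eventually_subseq. intros n; lia. }
  apply is_lim_seq_even_odd.
  - revert He. apply is_lim_seq_ext. intros n. rewrite pow_1_even. ring.
  - assert (Hd : is_lim_seq (fun n => (alt_xlnx (S (2 * n)) + boundary (INR (S (2 * n))))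
        - (alt_xlnx (2 * n) - boundary (INR (2 * n)))) 0).
    { apply is_lim_seq_abs_0.
      apply (is_lim_seq_le_le_loc (fun _ => 0) _ (fun n => / INR n)).
      - exists 1%nat. intros n Hn. split; [apply Rabs_pos | apply alt_xlnx_odd_boundary, Hn].
      - apply is_lim_seq_const.
      - replace (Finite 0) with (Rbar_inv p_infty) by reflexivity.
        apply is_lim_seq_inv; [apply is_lim_seq_INR | discriminate]. }
    replace (3 * l - ln 2 / 3 - 1 / 4) with (0 + (3 * l - ln 2 / 3 - 1 / 4)) by ring.
    generalize (is_lim_seq_plus' _ _ _ _ Hd He).
    apply is_lim_seq_ext. intros n. rewrite pow_1_odd. ring.
Qed.

(** * The derivative at -1 *)

Lemma mean_alternating (f : R -> C) (k n : nat) :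
  mean k (fun n => RtoC ((-1) ^ n) * f (INR n))%C n
  = (RtoC ((-1) ^ n) * (RtoC ((/ 2) ^ k) * diff k f (INR n)))%C.
Proof.
  revert n; induction k as [|k IH]; intros n.
  - simpl. ring.
  - change (mean (S k) (fun n => RtoC ((-1) ^ n) * f (INR n))%C n) with
      (/ 2 * (mean k (fun n => RtoC ((-1) ^ n) * f (INR n)) n
       + mean k (fun n => RtoC ((-1) ^ n) * f (INR n)) (S n)))%C.
    rewrite !IH, (S_INR n).
    change (diff (S k) f (INR n)) with (diff k f (INR n) - diff k f (INR n + 1))%C.
    replace ((/ 2) ^ S k) with (/ 2 * (/ 2) ^ k) by reflexivity.
    replace ((-1) ^ S n) with (- (-1) ^ n) by (simpl; ring).
    rewrite RtoC_mult, RtoC_opp, RtoC_inv by lra. ring.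
Qed.

(** Averaging an alternating sequence k times leaves 2^-k times a k-th
    difference, which tends to 0 for large k even though the sequence may grow. *)
Lemma Euler_sum_alternating (c0 c1 c2 q : C) :
  Cmod c0 <= 1 -> Cmod c1 <= 1 -> Cmod c2 <= 1 ->
  Euler_sum (fun n => RtoC ((-1) ^ n) * log_power c0 c1 c2 q (INR n))%C 0%C.
Proof.
  intros H0 H1 H2. destruct (exists_INR_ge (4 + Cmod q)) as [k Hk].
  exists k.
  (* The index 0 is dropped: the bounds on differences need an argument at least 1. *)
  apply Clim_succ.
  apply (Clim_0_squeeze _ (fun n => diff_const k (Cmod q) * / INR (S n) ^ 2)).
  - intros n. rewrite mean_alternating, !Cmod_mult, Cmod_sign, Cmod_R, Rmult_1_l.
    assert (Hn : 1 <= INR (S n)) by (rewrite S_INR; assert (X := pos_INR n); lra).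
    assert (B : Cmod (diff k (log_power c0 c1 c2 q) (INR (S n)))
       <= diff_const k (Cmod q) * 1 / INR (S n) ^ 2).
    { apply diff_log_power_bound; auto; [lra|].
      assert (X := re_le_Cmod q). apply Rabs_le_between in X. lra. }
    rewrite Rmult_1_r in B. unfold Rdiv in B.
    eapply Rle_trans; [|exact B].
    rewrite <- (Rmult_1_l (Cmod (diff _ _ _))) at 2.
    apply Rmult_le_compat_r; [apply Cmod_ge_0|].
    rewrite Rabs_pos_eq by (apply pow_le; lra).
    rewrite <- (pow1 k). apply pow_incr; lra.
  - replace (Finite 0) with (Rbar_mult (diff_const k (Cmod q)) 0) by (simpl; f_equal; ring).
    apply is_lim_seq_scal_l. apply ex_series_lim_0, ex_series_inv_sq.
Qed.

(** The differentiated partial sums are a convergent sequence plus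
    (-1)^N boundary(N).  The amplitude is split according to the power of x: x ln x / 2
    is a [log_power] of exponent -1, and (1 + ln x) / 4 one of exponent 0. *)
Lemma Euler_sum_alt_xlnx (l : R) : is_lim_seq ln_glaisher_seq l ->
  Euler_sum (eta_sums 0 (-(1)) 0 (RtoC (-1))) (RtoC (3 * l - ln 2 / 3 - 1 / 4)).
Proof.
  intros Hl.
  assert (M0 : Cmod 0 <= 1) by (rewrite Cmod_0; lra).
  assert (M2 : Cmod (RtoC (/ 2)) <= 1) by (rewrite Cmod_R, Rabs_pos_eq; lra).
  assert (M4 : Cmod (RtoC (/ 4)) <= 1) by (rewrite Cmod_R, Rabs_pos_eq; lra).
  assert (S1 : Euler_sum (fun n => RtoC (alt_xlnx n - (-1) ^ n * boundary (INR n)))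
     (RtoC (3 * l - ln 2 / 3 - 1 / 4))).
  { apply Euler_sum_Clim. split; [exact (alt_xlnx_limit l Hl) | exact (is_lim_seq_const 0)]. }
  assert (S2 := Euler_sum_alternating 0 (RtoC (/ 2)) 0 (RtoC (-1)) M0 M2 M0).
  assert (S3 := Euler_sum_alternating (RtoC (/ 4)) (RtoC (/ 4)) 0 0 M4 M4 M0).
  assert (S := Euler_sum_plus _ _ _ _ S1 (Euler_sum_plus _ _ _ _ S2 S3)).
  rewrite !Cplus_0_r in S. destruct S as [k Hk].
  exists k.
  (* At index 0 the argument of the logarithm would be 0. *)
  apply Clim_succ in Hk. apply Clim_succ. revert Hk. apply Clim_ext. intros n.
  rewrite <- !mean_succ. apply mean_ext. clear n. intros n.
  rewrite eta_sums_at_m1.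
  assert (X : 0 < INR (S n)) by (apply lt_0_INR; lia).
  unfold log_power, Rpow_neg, boundary.
  replace (- RtoC (-1) * RtoC (ln (INR (S n))))%C with (RtoC (ln (INR (S n))))
    by ring.
  replace (- 0 * RtoC (ln (INR (S n))))%C with (RtoC 0) by ring.
  rewrite !Cexp_RtoC, exp_0, exp_ln by assumption.
  rewrite RtoC_minus, !RtoC_mult, !RtoC_plus, !RtoC_mult. ring.
Qed.

Theorem corollary3p5 :
  zeta_reg_prod = RtoC (Rpower 2 (- (1 / 3)) * exp (- (1 / 4)) * glaisher ^ 3)%R.
Proof.
  destruct exists_continuation as [f [f' [Hf Hf']]].
  destruct glaisher_limit as [l [Hl ->]].
  assert (Z : is_zetaE zetaE).
  { unfold zetaE. apply epsilon_spec. exists f. apply (Euler_sum_is_zetaE f f' Hf Hf'). }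
  assert (E := is_zetaE_unique f zetaE (Euler_sum_is_zetaE f f' Hf Hf') Z).
  assert (D : @is_derive C_AbsRing C_NormedModule zetaE (RtoC (-1)) (f' (RtoC (-1)))).
  { apply (is_derive_ext f); [exact E | apply (Euler_sum_is_derive f f' Hf Hf')]. }
  unfold zeta_reg_prod. rewrite (is_C_derive_unique _ _ _ D).
  rewrite (Euler_sum_unique _ _ _ (Hf' (RtoC (-1))) (Euler_sum_alt_xlnx l Hl)).
  rewrite Cexp_RtoC. f_equal. unfold Rpower.
  replace (exp l ^ 3) with (exp l * (exp l * exp l)) by ring.
  rewrite <- !exp_plus. f_equal. field.
Qed.
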